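(* Let $\mathcal{G}=(V,E)$ be a connected, undirected, decomposable (chordal) graph, let $v\in V$, and let $C_1,\dots,C_N$ be its maximal cliques, ordered so that the running intersection property holds and $v\in C_1$, with separators $S_2,\dots,S_N$ and $S_1:=\{v\}$. Let $\boldsymbol X_E=(X_{E,1},\dots,X_{E,d})$ be a graphical model relative to $\mathcal{G}$ that satisfies Assumptions $A_0$, $A_1$ and $A_2$ (all stated in the context). Then, as $t\to\infty$, $$\left(X_{E,v}-t,\ \frac{\boldsymbol X_{E,V\setminus v}-\boldsymbol a^{(v)}_{V\setminus v}(X_{E,v})}{\boldsymbol b^{(v)}_{V\setminus v}(X_{E,v})}\right)\ \Bigg|\ \{X_{E,v}>t\}\ \overset{d}{\longrightarrow}\ \left(E_v,\ \boldsymbol Z^{(v)}_{V\setminus v}\right),$$ where (i) $E_v$ is a unit exponential random variable that is independent of $\boldsymbol Z^{(v)}_{V\setminus v}$; (ii) for $i=1,\dots,N$, $$\boldsymbol Z^{(v)}_{C_i\setminus S_i}=\boldsymbol\psi^{(S_i)}_{C_i\setminus S_i}\big(\boldsymbol Z^{(v)}_{S_i}\big)+\boldsymbol\phi^{(S_i)}_{C_i\setminus S_i}\big(\boldsymbol Z^{(v)}_{S_i}\big)\,\boldsymbol\varepsilon^{(v)}_{C_i\setminus S_i},$$ where $Z^{(v)}_v=0$ almost surely, $\boldsymbol\varepsilon^{(v)}_{C_i\setminus S_i}\sim G^{(S_i)}_{C_i\setminus S_i}$ for $i=1,\dots,N$, and the random vectors $\boldsymbol\varepsilon^{(v)}_{C_{i_1}\setminus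 S_{i_1}}$ and $\boldsymbol\varepsilon^{(v)}_{C_{i_2}\setminus S_{i_2}}$ are independent when $i_1\neq i_2$.
   Context: **Notation.** $V=\{1,\dots,d\}$. For $A\subseteq V$, $\boldsymbol x_A=(x_u: u\in A)$; $V\setminus v$ means $V\setminus\{v\}$, and $C_1\setminus v$ means $C_1\setminus\{v\}$; $|A|$ is the cardinality of $A$; $\boldsymbol 1_k$ is the vector of ones in $\mathbb R^k$. All operations and inequalities on vectors are componentwise. $\overset{d}{\to}$ is convergence in distribution and $\overset{w}{\to}$ weak convergence of probability distributions. A family of probability distributions $\mu_{t,\boldsymbol z}$ converges weakly to $\mu$ as $t\to\infty$ uniformly in compact sets of $\boldsymbol z$ if, for every bounded continuous $f$ and every compact set $K$, $\sup_{\boldsymbol z\in K}|\int f\,d\mu_{t,\boldsymbol z}-\int f\,d\mu|\to0$. $\mathbb R_+$ denotes the non-negative reals; scale functions $\boldsymbol b$, by which one divides, have positive components. **Graphs.** Graphs are finite, undirected, without loops or parallel edges. A graph is decomposable (chordal) if every cycle of length at least four has an edge joining two non-consecutive vertices of the cycle. The maximal cliques of a connected chordal graph can be ordered as $C_1,\dots,C_N$ so that the running intersection property holds: for $i=2,\dots,N$, $S_i:=C_i\cap\big(\bigcup_{j=1}^{i-1}C_j\big)\subset C_k$ for some $k<i$. The first clique may be chosen arbitrarily; here it is chosen with $v\in C_1$. **Graphical model.** $\boldsymbol X_E$ is a graphical model relative to $\mathcal G$ if it satisfies the pairwise Markov property ($X_{E,i}$ and $X_{E,j}$ are conditionally independent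 given $\boldsymbol X_{E,V\setminus\{i,j\}}$ for all $i\ne j$ with $(i,j)\notin E$), and its law is described by Markov transition kernels $\mathbb P(\boldsymbol X_{E,C_i\setminus S_i}\in\cdot\mid\boldsymbol X_{E,S_i}=\boldsymbol x_{S_i})$, in the sense that for $i=2,\dots,N$ the conditional law of $\boldsymbol X_{E,C_i\setminus S_i}$ given $\boldsymbol X_{E,C_1\cup\dots\cup C_{i-1}}$ equals its conditional law given $\boldsymbol X_{E,S_i}$. Conditional probabilities given point values below refer to these kernels (and to a regular conditional distribution of $\boldsymbol X_{E,C_1\setminus v}$ given $X_{E,v}$). **Assumption $A_0$.** All marginals are unit exponential: $\mathbb P(X_{E,u}\le x)=(1-e^{-x})_+$ for all $u\in V$. **Assumption $A_1$.** There exist measurable functions $\boldsymbol a^{(v)}_{C_1\setminus v}:\mathbb R\to\mathbb R^{|C_1|-1}$ and $\boldsymbol b^{(v)}_{C_1\setminus v}:\mathbb R\to\mathbb R_+^{|C_1|-1}$ such that $\boldsymbol a^{(v)}_{C_1\setminus v}(t)+\boldsymbol b^{(v)}_{C_1\setminus v}(t)\boldsymbol z\to\infty\,\boldsymbol 1_{|C_1|-1}$ as $t\to\infty$ for all $\boldsymbol z\in\mathbb R^{|C_1|-1}$, and a distribution function $G^{(v)}_{C_1\setminus v}$ supported on $\mathbb R^{|C_1|-1}$ with non-degenerate marginal distributions such that, as $t\to\infty$, $$\mathbb P\left(\frac{\boldsymbol X_{E,C_1\setminus v}-\boldsymbol a^{(v)}_{C_1\setminus v}(X_{E,v})}{\boldsymbol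 b^{(v)}_{C_1\setminus v}(X_{E,v})}\le\boldsymbol z_{C_1\setminus v}\ \Big|\ X_{E,v}=t\right)\overset{w}{\longrightarrow}G^{(v)}_{C_1\setminus v}(\boldsymbol z_{C_1\setminus v}).$$ **Assumption $A_2$.** (i) There exist measurable functions $\boldsymbol a^{(v)}_{V\setminus v}:\mathbb R_+\to\mathbb R_+^{|V|-1}$ and $\boldsymbol b^{(v)}_{V\setminus v}:\mathbb R_+\to\mathbb R_+^{|V|-1}$ with $\boldsymbol a^{(v)}_{V\setminus v}(t)+\boldsymbol b^{(v)}_{V\setminus v}(t)\boldsymbol z\to\infty\,\boldsymbol1_{|V|-1}$ as $t\to\infty$ for all $\boldsymbol z\in\mathbb R^{|V|-1}$, whose $C_1\setminus v$ components are the norming functions of Assumption $A_1$. For $i=2,\dots,N$ there exist measurable functions $\boldsymbol a^{(S_i)}_{C_i\setminus S_i},\boldsymbol b^{(S_i)}_{C_i\setminus S_i}:\mathbb R_+^{|S_i|}\to\mathbb R_+^{|C_i\setminus S_i|}$ and continuous update functions $\boldsymbol\psi^{(S_i)}_{C_i\setminus S_i}:\mathbb R^{|S_i|}\to\mathbb R^{|C_i\setminus S_i|}$, $\boldsymbol\phi^{(S_i)}_{C_i\setminus S_i}:\mathbb R^{|S_i|}\to\mathbb R_+^{|C_i\setminus S_i|}$ such that, with $\boldsymbol T^{(v)}_{S_i}(\boldsymbol z_{S_i},t)=\boldsymbol a^{(v)}_{S_i}(t)+\boldsymbol b^{(v)}_{S_i}(t)\boldsymbol z_{S_i}$, for all $\boldsymbol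 z_{S_i}\in\mathbb R^{|S_i|}$, $$\boldsymbol\psi^{(S_i)}_{C_i\setminus S_i}(\boldsymbol z_{S_i})=\lim_{t\to\infty}\frac{\boldsymbol a^{(S_i)}_{C_i\setminus S_i}\{\boldsymbol T^{(v)}_{S_i}(\boldsymbol z_{S_i},t)\}-\boldsymbol a^{(v)}_{C_i\setminus S_i}(t)}{\boldsymbol b^{(v)}_{C_i\setminus S_i}(t)},\qquad \boldsymbol\phi^{(S_i)}_{C_i\setminus S_i}(\boldsymbol z_{S_i})=\lim_{t\to\infty}\frac{\boldsymbol b^{(S_i)}_{C_i\setminus S_i}\{\boldsymbol T^{(v)}_{S_i}(\boldsymbol z_{S_i},t)\}}{\boldsymbol b^{(v)}_{C_i\setminus S_i}(t)},$$ and such that the remainder terms $$\frac{\boldsymbol a^{(v)}_{C_i\setminus S_i}(t)-\boldsymbol a^{(S_i)}_{C_i\setminus S_i}\{\boldsymbol T^{(v)}_{S_i}(\boldsymbol z_{S_i},t)\}+\boldsymbol b^{(v)}_{C_i\setminus S_i}(t)\boldsymbol\psi^{(S_i)}_{C_i\setminus S_i}(\boldsymbol z_{S_i})}{\boldsymbol b^{(S_i)}_{C_i\setminus S_i}\{\boldsymbol T^{(v)}_{S_i}(\boldsymbol z_{S_i},t)\}}\quad\text{and}\quad 1-\frac{\boldsymbol b^{(v)}_{C_i\setminus S_i}(t)\boldsymbol\phi^{(S_i)}_{C_i\setminus S_i}(\boldsymbol z_{S_i})}{\boldsymbol b^{(S_i)}_{C_i\setminus S_i}\{\boldsymbol T^{(v)}_{S_i}(\boldsymbol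 z_{S_i},t)\}}$$ converge to zero as $t\to\infty$, uniformly in compact sets of $\boldsymbol z_{S_i}\in\mathbb R^{|S_i|}$. If $v\in S_i$, the $v$-components are $a^{(v)}_v(t)=t$ and $b^{(v)}_v(t)=1$. (ii) For $i=2,\dots,N$ there exist distributions $G^{(S_i)}_{C_i\setminus S_i}$ supported on $\mathbb R^{|C_i\setminus S_i|}$ with non-degenerate marginal distributions such that, as $t\to\infty$, $$\mathbb P\left(\frac{\boldsymbol X_{E,C_i\setminus S_i}-\boldsymbol a^{(S_i)}_{C_i\setminus S_i}(\boldsymbol X_{E,S_i})}{\boldsymbol b^{(S_i)}_{C_i\setminus S_i}(\boldsymbol X_{E,S_i})}\le\boldsymbol y_{C_i\setminus S_i}\ \Big|\ \frac{\boldsymbol X_{E,S_i}-\boldsymbol a^{(v)}_{S_i}(t)}{\boldsymbol b^{(v)}_{S_i}(t)}=\boldsymbol z_{S_i}\right)\overset{w}{\longrightarrow}G^{(S_i)}_{C_i\setminus S_i}(\boldsymbol y_{C_i\setminus S_i}),$$ uniformly in compact sets in $\boldsymbol z_{S_i}\in\mathbb R^{|S_i|}$. **Convention for $i=1$.** $S_1=\{v\}$, $\boldsymbol\psi^{(S_1)}_{C_1\setminus S_1}\equiv0$, $\boldsymbol\phi^{(S_1)}_{C_1\setminus S_1}\equiv1$, and $G^{(S_1)}_{C_1\setminus S_1}=G^{(v)}_{C_1\setminus v}$. *)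

(* Defs.v *)
From HB Require Import structures.
From mathcomp Require Import all_boot all_order all_algebra.
From mathcomp Require Import all_classical all_reals all_analysis.
From mathcomp Require Import measurable_realfun.

Set Implicit Arguments.
Unset Strict Implicit.
Unset Printing Implicit Defensive.

Import Order.TTheory GRing.Theory Num.Theory.
Import numFieldNormedType.Exports.

Local Open Scope classical_set_scope.
Local Open Scope ring_scope.

(* The join of the two hierarchies lets a single definition of weak convergence
   serve both for R^A and for R * R^A.  No compatibility between the two
   structures is required by the class; on the instances used below the
   sigma-algebra is the Borel one. *)
#[short(type="topMeasurableType")]
HB.structure Definition TopMeasurable d :=
  {T of Measurable d T & Topological T}.

HB.saturate prod.
HB.saturate Real.sort.

(** * Vectors indexed by a set of vertices *)

(* R^A is the type of real functions on the elements of A, with the product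
   topology and the product sigma-algebra.  It is a one-point type when A is
   empty. *)
Definition vec (R : realType) (V : finType) (A : {set V}) : Type :=
  {u : V | u \in A} -> R.

Definition vec_display : measure_display -> measure_display.
Proof. exact. Qed.

Section vec_structures.
Context (R : realType) (V : finType) (A : {set V}).

HB.instance Definition _ :=
  Pointed.copy (vec R A) ({u : V | u \in A} -> R).
HB.instance Definition _ :=
  Uniform.copy (vec R A) {ptws {u : V | u \in A} -> R}.

Definition vec_measurable : set (set (vec R A)) :=
  <<s \bigcup_(u in [set: {u : V | u \in A}])
        preimage_set_system setT (fun x : vec R A => x u) measurable >>.

Let vec_measurable0 : vec_measurable set0.
Proof. exact: sigma_algebra0. Qed.

Let vec_measurableC B : vec_measurable B -> vec_measurable (~` B).
Proof. exact: sigma_algebraC. Qed.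

Let vec_measurable_bigcup (F : (set (vec R A))^nat) :
  (forall i, vec_measurable (F i)) -> vec_measurable (\bigcup_i F i).
Proof. exact: sigma_algebra_bigcup. Qed.

HB.instance Definition _ :=
  @isMeasurable.Build (vec_display default_measure_display) (vec R A)
    vec_measurable vec_measurable0 vec_measurableC vec_measurable_bigcup.

End vec_structures.

Section vec_operations.
Context (R : realType) (V : finType).
Implicit Types A : {set V}.

Definition subvec A (x : V -> R) : vec R A := fun u => x (val u).

Definition orthant A : set (vec R A) := [set x | forall u, 0 <= x u].

Definition standardize A (a b x : vec R A) : vec R A :=
  fun u => (x u - a u) / b u.

(* [destandardize a b z t] is T_A(z, t) = a_A(t) + b_A(t) z. *)
Definition destandardize A (a b : R -> V -> R) (z : vec R A) (t : R) :
    vec R A :=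
  fun u => a t (val u) + b t (val u) * z u.

End vec_operations.
Arguments subvec {R V} A x.
Arguments orthant {R V} A.

(** * Weak convergence *)

(* Laws are given by their set functions; integrals of bounded functions
   against them are finite, so that taking [fine] is harmless. *)
Section weak_convergence.
Context (R : realType) d (T : topMeasurableType d).

Definition bounded_continuous (f : T -> R) : Prop :=
  continuous f /\ exists M, forall x, `|f x| <= M.

Definition weakly_cvg (mu : R -> set T -> \bar R) (nu : set T -> \bar R) :
    Prop :=
  forall f : T -> R, bounded_continuous f ->
    fine (\int[mu t]_x (f x)%:E)%E @[t --> +oo]
      --> fine (\int[nu]_x (f x)%:E)%E.

Definition weakly_cvg_unif (U : topologicalType)
    (mu : R -> U -> set T -> \bar R) (nu : set T -> \bar R) : Prop :=
  forall f : T -> R, bounded_continuous f ->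
    {family compact, (fun t (z : U) => fine (\int[mu t z]_x (f x)%:E)%E) @ +oo
      --> (fun _ : U => fine (\int[nu]_x (f x)%:E)%E)}.

End weak_convergence.

(** * Conditioning and independence *)

Section conditioning.
Context (R : realType) dO (Omega : measurableType dO) (P : probability Omega R).

Definition unit_exponential (Y : {RV P >-> R}) : Prop :=
  forall x : R, cdf Y x = (Num.max (1 - expR (- x)) 0)%:E.

(* The law of Y given the event D, where P(D) > 0. *)
Definition law_given d (T : measurableType d) (D : set Omega) (Y : Omega -> T) :
    set T -> \bar R :=
  fun B => (fine (P (D `&` Y @^-1` B)) / fine (P D))%:E.

(* f is a version of the conditional probability P(D | sigma(Y)). *)
Definition is_cond_prob d (T : measurableType d) (Y : Omega -> T)
    (D : set Omega) (f : Omega -> \bar R) : Prop :=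
  (forall B : set (\bar R), measurable B ->
     exists2 B' : set T, measurable B' & f @^-1` B = Y @^-1` B') /\
  (forall B : set T, measurable B ->
     (\int[P]_(w in Y @^-1` B) f w = P (D `&` Y @^-1` B))%E).

(* Y1 and Y2 are conditionally independent given W.  Versions exist and are
   almost surely unique, so it does not matter which ones are multiplied. *)
Definition cond_independent d1 d2 d3 (T1 : measurableType d1)
    (T2 : measurableType d2) (T3 : measurableType d3)
    (Y1 : Omega -> T1) (Y2 : Omega -> T2) (W : Omega -> T3) : Prop :=
  forall (B1 : set T1) (B2 : set T2), measurable B1 -> measurable B2 ->
  forall f1 f2 : Omega -> \bar R,
    is_cond_prob W (Y1 @^-1` B1) f1 -> is_cond_prob W (Y2 @^-1` B2) f2 ->
    is_cond_prob W (Y1 @^-1` B1 `&` Y2 @^-1` B2) (fun w => f1 w * f2 w)%E.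

Definition independent d1 d2 (T1 : measurableType d1) (T2 : measurableType d2)
    (Y1 : Omega -> T1) (Y2 : Omega -> T2) : Prop :=
  forall (B1 : set T1) (B2 : set T2), measurable B1 -> measurable B2 ->
    (P (Y1 @^-1` B1 `&` Y2 @^-1` B2) = P (Y1 @^-1` B1) * P (Y2 @^-1` B2))%E.

Definition mutually_independent (I : finType) d (T : I -> measurableType d)
    (Y : forall i, Omega -> T i) : Prop :=
  forall (J : {set I}) (B : forall i, set (T i)),
    (forall i, measurable (B i)) ->
    (P (\bigcap_(i in [set` J]) (Y i @^-1` B i))
       = \prod_(i in J) P (Y i @^-1` B i))%E.

Definition subrv (V : finType) (A : {set V}) (X : V -> {RV P >-> R})
    (w : Omega) : vec R A :=
  subvec A (fun u => X u w).

End conditioning.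
Arguments subrv {R dO Omega P V} A X w.

(** * Decomposable graphs and their cliques *)

Section graphs.
Context (V : finType) (e : rel V).

Definition graph_connected : Prop := forall x y, connect e x y.

Definition chordal : Prop :=
  forall c : seq V, ucycle e c -> (4 <= size c)%N ->
    exists x y, [/\ x \in c, y \in c, e x y, y != next c x & x != next c y].

Definition clique (A : {set V}) : bool :=
  [forall x in A, forall y in A, (x != y) ==> e x y].

(* Cliques are numbered from 0: [C ord0] is C_1 and [C ord_max] is C_N, so the
   number of cliques is N.+1.  The separators include S_1 = {v}. *)
Context (v : V) (N : nat) (C : 'I_N.+1 -> {set V}).

Definition prev_cliques (i : 'I_N.+1) : {set V} :=
  (\bigcup_(j < N.+1 | (j < i)%N) C j)%SET.

Definition sep (i : 'I_N.+1) : {set V} :=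
  if i == ord0 then [set v]%SET else (C i :&: prev_cliques i)%SET.

Definition res (i : 'I_N.+1) : {set V} := (C i :\: sep i)%SET.

Record clique_ordering : Prop := {
  clique_inj : injective C ;
  clique_max : forall A, maxset clique A <-> exists i, C i = A ;
  clique_root : v \in C ord0 ;
  clique_rip : forall i, i != ord0 ->
    exists2 k : 'I_N.+1, (k < i)%N & sep i \subset C k }.

End graphs.

(** * The model and the assumptions *)

Section model.
Context (R : realType) dO (Omega : measurableType dO) (P : probability Omega R).
Context (V : finType) (e : rel V) (v : V) (N : nat) (C : 'I_N.+1 -> {set V}).
Context (X : V -> {RV P >-> R}).

Local Notation S := (sep v C).
Local Notation D := (res v C).

(* K i is the transition kernel P(X_{C_i \ S_i} in . | X_{S_i} = x_{S_i});
   K ord0 is the regular conditional distribution of X_{C_1 \ v} given X_v. *)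
Context (K : forall i, R.-pker (vec R (S i)) ~> (vec R (D i))).

Record graphical_model : Prop := {
  pairwise_markov : forall i j, i != j -> ~~ e i j ->
    cond_independent P (X i) (X j) (subrv (~: [set i; j])%SET X) ;
  kernel_sep : forall i (B : set (vec R (D i))), measurable B ->
    is_cond_prob P (subrv (S i) X) (subrv (D i) X @^-1` B)
      (fun w => K i (subrv (S i) X w) B) ;
  kernel_prev : forall i, i != ord0 ->
    forall B : set (vec R (D i)), measurable B ->
    is_cond_prob P (subrv (prev_cliques C i) X) (subrv (D i) X @^-1` B)
      (fun w => K i (subrv (S i) X w) B) }.

Definition assumption_A0 : Prop := forall u, unit_exponential (X u).

Definition nondegenerate_marginals (A : {set V})
    (G : probability (vec R A) R) : Prop :=
  forall u (c : R), G [set x | x u = c] != 1%E.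

Context (G : forall i, probability (vec R (D i)) R).

Record assumption_A1 (a1 b1 : R -> vec R (D ord0)) : Prop := {
  A1_measurable_a : measurable_fun setT a1 ;
  A1_measurable_b : measurable_fun setT b1 ;
  A1_pos_b : forall t u, 0 < b1 t u ;
  A1_growth : forall (z : vec R (D ord0)) u,
    a1 t u + b1 t u * z u @[t --> +oo] --> +oo ;
  A1_nondegenerate : nondegenerate_marginals (G ord0) ;
  A1_cvg : weakly_cvg
    (fun t => pushforward (K ord0 (fun=> t)) (standardize (a1 t) (b1 t)))
    (G ord0) }.

(* The normings a^{(v)}, b^{(v)} carry a component for every vertex, since
   T^{(v)}_{S_i} needs the v-components when v is in S_i; these are constrained
   only in that case.  Functions with domain R_+ or R_+^k are total functions
   constrained on that domain only. *)
Record assumption_A2 (a1 b1 : R -> vec R (D ord0)) (a b : R -> V -> R)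
    (aS bS psi phi : forall i, vec R (S i) -> vec R (D i)) : Prop := {
  A2_measurable_a :
    measurable_fun [set t : R | 0 <= t] (fun t => subvec [set~ v]%SET (a t)) ;
  A2_measurable_b :
    measurable_fun [set t : R | 0 <= t] (fun t => subvec [set~ v]%SET (b t)) ;
  A2_ge0_a : forall t u, 0 <= t -> u != v -> 0 <= a t u ;
  A2_pos_b : forall t u, 0 <= t -> u != v -> 0 < b t u ;
  A2_growth : forall (z : vec R [set~ v]%SET) u,
    destandardize a b z t u @[t --> +oo] --> +oo ;
  A2_a1 : forall t, 0 <= t -> subvec (D ord0) (a t) = a1 t ;
  A2_b1 : forall t, 0 <= t -> subvec (D ord0) (b t) = b1 t ;
  A2_v : forall i, i != ord0 -> v \in S i ->
    forall t, 0 <= t -> a t v = t /\ b t v = 1 ;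
  A2_measurable_aS : forall i, i != ord0 ->
    measurable_fun (orthant (S i)) (aS i) ;
  A2_measurable_bS : forall i, i != ord0 ->
    measurable_fun (orthant (S i)) (bS i) ;
  A2_ge0_aS : forall i, i != ord0 ->
    forall x u, orthant (S i) x -> 0 <= aS i x u ;
  A2_pos_bS : forall i, i != ord0 ->
    forall x u, orthant (S i) x -> 0 < bS i x u ;
  A2_continuous_psi : forall i, i != ord0 -> continuous (psi i) ;
  A2_continuous_phi : forall i, i != ord0 -> continuous (phi i) ;
  A2_ge0_phi : forall i, i != ord0 -> forall z u, 0 <= phi i z u ;
  A2_psi : forall i, i != ord0 -> forall z u,
    (aS i (destandardize a b z t) u - a t (val u)) / b t (val u)
      @[t --> +oo] --> psi i z u ;
  A2_phi : forall i, i != ord0 -> forall z u,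
    bS i (destandardize a b z t) u / b t (val u)
      @[t --> +oo] --> phi i z u ;
  A2_remainder_a : forall i, i != ord0 -> forall u,
    {family compact,
      (fun t (z : vec R (S i)) =>
         (a t (val u) - aS i (destandardize a b z t) u
            + b t (val u) * psi i z u)
         / bS i (destandardize a b z t) u) @ +oo
      --> (fun _ : vec R (S i) => 0 : R)} ;
  A2_remainder_b : forall i, i != ord0 -> forall u,
    {family compact,
      (fun t (z : vec R (S i)) =>
         1 - b t (val u) * phi i z u / bS i (destandardize a b z t) u) @ +oo
      --> (fun _ : vec R (S i) => 0 : R)} ;
  A2_nondegenerate : forall i, i != ord0 -> nondegenerate_marginals (G i) ;
  A2_cvg : forall i, i != ord0 -> weakly_cvg_unif
    (fun t (z : vec R (S i)) =>
       let x := destandardize a b z t in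
       pushforward (K i x) (standardize (aS i x) (bS i x)))
    (G i) }.

End model.

(* Main.v *)
(* Run through the cliques in the running-intersection order, keeping the vector
   of normed coordinates seen so far, with 0 elsewhere.  Given X_v = s, clique i
   acts on a function h of this vector by an operator
     h |-> (z |-> E[h(z updated on C_i \ S_i) | S_i-coordinates z, X_v = s]).
   By the Markov kernels, E[f(X_v, Z)] is the expectation of the composite of
   these operators evaluated at the origin.  The assumptions say that each
   operator preserves "h_s -> h locally uniformly as s -> oo", the limit operator
   integrating h against psi(z) + phi(z) eps, so the composite converges without
   any tightness argument for the intermediate laws; only the weak limits G_i need
   to be tight.  The lack of memory of X_v turns the conditioning on X_v > t into
   the shift s = t + X_v, and dominated convergence concludes.  The limit lives on
   Omega * R^V: E is X_v itself, and the noise vectors are the restrictions of a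
   random element of R^V to the disjoint sets C_i \ S_i. *)
Require Import Defs.
From HB Require Import structures.
From mathcomp Require Import all_boot all_order all_algebra.
From mathcomp Require Import all_classical all_reals all_analysis.
From mathcomp Require Import measurable_realfun.
From mathcomp Require Import ring lra.

Set Implicit Arguments.
Unset Strict Implicit.
Unset Printing Implicit Defensive.

Import Order.TTheory GRing.Theory Num.Theory.
Import numFieldNormedType.Exports.

Local Open Scope classical_set_scope.
Local Open Scope ring_scope.

(** * Topology and measurability of R^A *)

Section vectors.
Context (R : realType) (V : finType).
Implicit Types A B : {set V}.

(** Two mismatches shape the definitions. The kernel of a later clique is normed by functions of the
    separator values, whereas the limit is normed by functions of X_v alone. Passing from one
    norming to the other is an affine map of the residual vector, and its coefficients must converge
    jointly in the level s and in the state; these joint limits are extracted from the remainder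
    terms of the assumptions. Moreover, the kernels are only measurable in the state, so continuity
    cannot be carried along before the limit: the induction hypothesis is convergence along a
    product filter, whose limit is continuous by itself. Norming by X_v instead of t makes
    everything but X_v integrate out to a function of X_v, so the factor exp(-t) from the lack of
    memory cancels exactly against P(X_v > t). Interchanges of integrals rest on Tonelli, hence the
    test functions between 0 and B; a bounded f is first shifted by a constant. *)

Lemma cvg_vec (I : Type) (F : set_system I) (FF : Filter F) A (f : I -> vec R A)
    (l : vec R A) :
  (forall u, f x u @[x --> F] --> l u) -> f x @[x --> F] --> l.
Proof.
move=> fl; apply/cvg_sup => u W /=.
rewrite (@nbhsE (initial_topology (fun f : {u : V | u \in A} -> R => f u))).
move=> [B [[U oU <-] Ul] BW].
have h : nbhs (f x u @[x --> F]) U by apply: fl; exact: open_nbhs_nbhs.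
apply: (@filterS _ F FF _ _ _ h) => x; exact: BW.
Qed.

Lemma vec_proj_continuous A (u : {u : V | u \in A}) :
  continuous (fun x : vec R A => x u).
Proof. exact: proj_continuous. Qed.

Lemma cvg_proj (I : Type) (F : set_system I) (FF : Filter F) A
    (f : I -> vec R A) (l : vec R A) u :
  f x @[x --> F] --> l -> f x u @[x --> F] --> l u.
Proof. by move=> fl; exact: (cvg_comp _ _ fl (@vec_proj_continuous A u l)). Qed.

Lemma measurable_vec_proj A (u : {u : V | u \in A}) :
  measurable_fun setT (fun x : vec R A => x u).
Proof.
move=> _ B mB; rewrite setTI; apply: sub_sigma_algebra.
by exists u => //; exists B => //; rewrite setTI.
Qed.

Lemma measurable_vec d (T : measurableType d) (D : set T) A (f : T -> vec R A) :
  measurable D ->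
  (forall u, measurable_fun D (fun x => f x u)) -> measurable_fun D f.
Proof.
move=> mD mf; apply: (@measurability _ _ _ _ D f
  (\bigcup_(u in [set: {u : V | u \in A}])
        preimage_set_system setT (fun x : vec R A => x u) measurable)) => //.
move=> _ [_ [u _ [B mB <-]] <-].
by rewrite setTI; exact: mf.
Qed.

Lemma measurable_standardize A (a b : vec R A) :
  measurable_fun setT (standardize a b).
Proof.
apply: measurable_vec => // u; apply: measurable_funM => //.
by apply: measurable_funB => //; exact: measurable_vec_proj.
Qed.

Definition box A (c : vec R A) (r : R) : set (vec R A) :=
  [set x | forall u, `|x u - c u| <= r].

Lemma compact_box A (c : vec R A) r : compact (box c r).
Proof.
have := @tychonoff {u : V | u \in A} (fun=> R)
  (fun u => [set y | `|y - c u| <= r]).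
apply => u; rewrite (_ : [set _ | _] = `[c u - r, c u + r]%classic).
  exact: segment_compact.
by apply/seteqP; split=> y /=; rewrite in_itv/= ler_distl.
Qed.

(** Finiteness of the index set makes a box a neighbourhood. Boxes are thus compact neighbourhoods,
    which is what turns uniformity on compact sets into convergence along a product filter. *)
Lemma nbhs_box A (c : vec R A) r : 0 < r -> nbhs c (box c r).
Proof.
move=> r0; rewrite /box.
apply: (@filter_forall _ _ (fun u x => `|x u - c u| <= r) (nbhs c)) => u.
have /cvgrPdist_le/(_ _ r0) := @vec_proj_continuous A u c.
by apply: filterS => x; rewrite distrC.
Qed.

End vectors.

(** * Measurability of continuous functions by rounding *)

Section discretization.
Context (R : realType).

(* A substitute for second countability: continuous real functions are then
   measurable for the given sigma-algebra, a priori unrelated to the topology. *)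
Definition discretizable d (T : topMeasurableType d) : Prop :=
  exists (I : countType) (code : nat -> T -> I) (decode : nat -> I -> T),
    (forall n i, measurable (code n @^-1` [set i])) /\
    (forall x, decode n (code n x) @[n --> \oo] --> x).

(** Composed with rounding, [f] takes countably many values on measurable pieces; by continuity
    these composites converge pointwise to [f]. *)
Lemma discretizable_continuous_measurable d (T : topMeasurableType d)
    (f : T -> R) :
  discretizable T -> continuous f -> measurable_fun setT f.
Proof.
move=> [I [code [decode [mcode cvgcode]]]] cf.
apply: (@measurable_fun_cvg _ _ _ _ (fun n x => f (decode n (code n x)))).
  move=> n _ B mB; rewrite setTI.
  rewrite (_ : _ @^-1` B = \bigcup_i
      [set x | code n x = i /\ B (f (decode n i))]).
    apply: countable_bigcupT_measurable => [|i]; first exact: countableP.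
    have [Bi|Bi] := pselect (B (f (decode n i))).
      rewrite (_ : [set x | _] = code n @^-1` [set i]) //.
      by apply/seteqP; split=> x //= [].
    rewrite (_ : [set x | _] = set0) //.
    by apply/seteqP; split=> x //= [].
  apply/seteqP; split=> x /=; first by move=> Bx; exists (code n x).
  by move=> [i _ [<-]].
by move=> x _; exact: (cvg_comp _ _ (cvgcode x) (cf x)).
Qed.

Lemma measurable_floor_mul (c : R) (k : int) :
  measurable [set x : R | Num.floor (x * c) = k].
Proof.
rewrite (_ : [set _ | _] = (fun x => x * c) @^-1` `[k%:~R, (k + 1)%:~R[).
  by rewrite -[_ @^-1` _]setTI; exact: mulrr_measurable.
apply/seteqP; split=> x /=; rewrite in_itv/=.
  by move=> <-; exact: floor_itv.
by move/floor_def.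
Qed.

Lemma cvg_floor_mul (x : R) :
  (Num.floor (x * n.+1%:R))%:~R / n.+1%:R @[n --> \oo] --> x.
Proof.
apply/cvgrPdist_le => e e0; near=> n.
have n0 : 0 < n.+1%:R :> R by rewrite ltr0n.
have /andP[h1 h2] := floor_itv (x * n.+1%:R).
set k : R := _%:~R in h1 *.
rewrite -(ler_pM2r n0) -[X in _ * X <= _](gtr0_norm n0) -normrM mulrBl.
rewrite divfK ?gt_eqF// ler_norml.
have ne : 1 <= e * n.+1%:R.
  rewrite -ler_pdivrMl// mulr1 (@le_trans _ _ n%:R) ?ler_nat//; near: n.
  exact: nbhs_infty_ger.
rewrite intrD -/k in h2.
by set y := x * _ in h1 h2 *; set z := e * _ in ne *; lra.
Unshelve. all: by end_near. Qed.

(** Every coordinate is rounded down to the grid of mesh 1/(n+1); since [V] is finite, the codes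
    form a countable type. *)
Lemma discretizable_vec (V : finType) (A : {set V}) : discretizable (vec R A).
Proof.
exists {ffun {u : V | u \in A} -> int},
  (fun n x => [ffun u => Num.floor (x u * n.+1%:R)]),
  (fun n (k : {ffun {u : V | u \in A} -> int}) u => (k u)%:~R / n.+1%:R); split.
  move=> n k.
  rewrite (_ : _ @^-1` _ = \bigcap_(u in [set: {u : V | u \in A}])
     ((fun x : vec R A => x u) @^-1`
        [set y : R | Num.floor (y * n.+1%:R) = k u])).
    apply: fin_bigcap_measurable => //.
    move=> u _; rewrite -[_ @^-1` _]setTI; apply: measurable_vec_proj => //.
    exact: measurable_floor_mul.
  apply/seteqP; split=> x /=; first by move=> <- u _ /=; rewrite ffunE.
  by move=> h; apply/ffunP => u; rewrite ffunE; exact: h.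
move=> x; apply: cvg_vec => u.
rewrite (_ : (fun n => _) = (fun n =>  (Num.floor (x u * n.+1%:R))%:~R / n.+1%:R)).
  exact: cvg_floor_mul.
by apply/funext => n; rewrite ffunE.
Qed.

Lemma discretizable_prod (V : finType) (A : {set V}) :
  discretizable (R * vec R A)%type.
Proof.
have [I [code [decode [mcode cvgcode]]]] := discretizable_vec A.
exists (int * I)%type, (fun n x => (Num.floor (x.1 * n.+1%:R), code n x.2)),
  (fun n k => (k.1%:~R / n.+1%:R, decode n k.2)); split.
  move=> n [k i].
  rewrite (_ : _ @^-1` _ =
    [set y : R | Num.floor (y * n.+1%:R) = k] `*` (code n @^-1` [set i])).
    by apply: measurableX => //; exact: measurable_floor_mul.
  by apply/seteqP; split=> -[x y]/= [-> ->].
move=> [x y]; apply: (@cvg_pair _ _ _ _ (nbhs x) (nbhs y)) => /=.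
  exact: cvg_floor_mul.
exact: cvgcode.
Qed.

End discretization.

(** * Weak convergence with varying integrands *)

Section bounded_integrals.
Context (R : realType) d (T : measurableType d).
Variable mu : {measure set T -> \bar R}.
Hypothesis mu1 : mu setT = 1%E.

Lemma integrable_bounded (f : T -> R) (M : R) :
  measurable_fun setT f -> (forall x, `|f x| <= M) ->
  mu.-integrable setT (EFin \o f).
Proof.
move=> mf fM; apply: measurable_bounded_integrable => //.
  by rewrite mu1 ltry.
by exists M; split; [exact: num_real|move=> r Mr x _; exact: le_trans (fM x) (ltW Mr)].
Qed.

Lemma Rintegral_prob_cst (r : R) : \int[mu]_x r = r.
Proof. by rewrite Rintegral_cst// mu1 mulr1. Qed.

Lemma integrable_between (f : T -> R) (a b : R) : measurable_fun setT f ->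
  (forall x, a <= f x <= b) -> mu.-integrable setT (EFin \o f).
Proof.
move=> mf fab.
apply: (@integrable_bounded _ (Num.max `|a| `|b|)) => // x.
have /andP[h1 h2] := fab x.
rewrite ler_norml le_max lerNl le_max; apply/andP; split; apply/orP.
  by left; rewrite (@le_trans _ _ (- a)) ?lerN2// -normrN ler_norm.
by right; rewrite (le_trans h2)// ler_norm.
Qed.

Lemma Rintegral_bounds (f : T -> R) (a b : R) : measurable_fun setT f ->
  (forall x, a <= f x <= b) -> a <= \int[mu]_x f x <= b.
Proof.
move=> mf fab; have intf := integrable_between mf fab.
have intc (r : R) : mu.-integrable setT (EFin \o (fun=> r)).
  by apply: (@integrable_bounded _ `|r|).
apply/andP; split.
  rewrite -[leLHS]Rintegral_prob_cst; apply: le_Rintegral => // x _.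
  by have /andP[] := fab x.
rewrite -[leRHS]Rintegral_prob_cst; apply: le_Rintegral => // x _.
by have /andP[] := fab x.
Qed.

Lemma EFin_Rintegral (f : T -> R) (a b : R) : measurable_fun setT f ->
  (forall x, a <= f x <= b) -> (\int[mu]_x f x)%:E = (\int[mu]_x (f x)%:E)%E.
Proof.
move=> mf fab; rewrite fineK//; apply: integrable_fin_num => //.
exact: integrable_between fab.
Qed.

(** A bounded [f] enters the arguments for nonnegative integrands as [f + M]; this undoes the
    shift. *)
Lemma Rintegral_shift (f : T -> R) (M : R) : measurable_fun setT f ->
  (forall x, `|f x| <= M) -> \int[mu]_x f x = \int[mu]_x (f x + M) - M.
Proof.
move=> mf fM; rewrite RintegralD//.
- by rewrite Rintegral_prob_cst addrK.
- exact: integrable_bounded fM.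
- by apply: (@integrable_bounded _ `|M|).
Qed.

End bounded_integrals.

Section joint_limits.
Context (R : realType) (I : Type) (F : set_system I) (FF : ProperFilter F).

(** An index [i] that serves both the convergence at [y0] and that at a nearby [y] links [g0 y0] to
    [g0 y] through [g i y]; the limit is continuous even when no [g i] is. *)
Lemma joint_cvg_continuous (T : topologicalType) (g : I -> T -> R) (g0 : T -> R) :
  (forall y0, g p.1 p.2 @[p --> filter_prod F (nbhs y0)] --> g0 y0) ->
  continuous g0.
Proof.
move=> gg0 y0; apply/cvgrPdist_le => e e0.
have e20 : 0 < e / 2 by rewrite divr_gt0.
have /cvgrPdist_le/(_ _ e20) [[U V]/= [FU nV] UV] := gg0 y0.
near=> y.
have Vy : V y by near: y.
have /cvgrPdist_le/(_ _ e20) [[U' V']/= [FU' nV'] UV'] := gg0 y.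
have [i [Ui U'i]] := filter_ex (filterI FU FU').
have h1 := UV (i, y) (conj Ui Vy).
have h2 := UV' (i, y) (conj U'i (nbhs_singleton nV')).
rewrite /= in h1 h2.
rewrite (splitr e) (le_trans _ (lerD h1 h2))// -[X in _ <= _ + X]normrN opprB.
by rewrite (le_trans _ (ler_normD _ _))// addrA subrK.
Unshelve. all: by end_near. Qed.

End joint_limits.

Section cutoff.
Context (R : realType) (V : finType) (A : {set V}).

(** A continuous stand-in for the indicator of the complement of a box: 0 on the box of radius [M],
    1 off that of radius [M + 1]. Unlike the indicator, it is a test function for weak
    convergence. *)
Definition cutoff (M : R) (y : vec R A) : R :=
  Num.min 1 (\sum_u Num.max 0 (`|y u| - M)).

Lemma continuous_cutoff M : continuous (cutoff M).
Proof.
have cmax (T : topologicalType) (f g : T -> R) : continuous f -> continuous g ->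
    continuous (fun x => Num.max (f x) (g x)).
  by move=> cf cg x; apply: (@continuous_max R T f g x); [exact: cf|exact: cg].
have cmin (T : topologicalType) (f g : T -> R) : continuous f -> continuous g ->
    continuous (fun x => Num.min (f x) (g x)).
  by move=> cf cg x; apply: (@continuous_min R T f g x); [exact: cf|exact: cg].
apply: cmin; first exact: cst_continuous.
apply: (@continuous_big _ _ _ _ _ add_continuous) => u _.
apply: (cmax _ (fun=> 0) (fun y : vec R A => `|y u| - M)); first exact: cst_continuous.
move=> y; apply: (@cvgB _ _ _ (nbhs y) _ (fun x : vec R A => `|x u|) (fun=> M)).
  by apply: cvg_norm; exact: vec_proj_continuous.
exact: cvg_cst.
Qed.

Lemma cutoff_bounds M y : 0 <= cutoff M y <= 1.
Proof.
rewrite /cutoff le_min ler01 /= ge_min lexx /= andbT.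
by apply: sumr_ge0 => u _; rewrite le_max lexx.
Qed.

Lemma cutoff_out M y : ~ box (fun=> 0) (M + 1) y -> cutoff M y = 1.
Proof.
move=> /existsNP[u /negP]; rewrite subr0 -ltNge => hu.
apply/min_idPl; rewrite (bigD1 u)//= -[leLHS]addr0 lerD//.
  by rewrite le_max; apply/orP; right; lra.
by apply: sumr_ge0 => w _; rewrite le_max lexx.
Qed.

Lemma cutoff_eq0 M y : (forall u, `|y u| <= M) -> cutoff M y = 0.
Proof.
move=> h; rewrite /cutoff big1 ?min_r// => u _.
by apply/max_idPl; rewrite subr_le0.
Qed.

Lemma measurable_cutoff M : measurable_fun setT (cutoff M).
Proof.
apply: discretizable_continuous_measurable; last exact: continuous_cutoff.
exact: discretizable_vec.
Qed.

(** This is the tightness of a single law: every point lies eventually in the box of radius [n],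
    where the cutoff vanishes. *)
Lemma cvg_cutoff (G : probability (vec R A) R) :
  \int[G]_y cutoff n%:R y @[n --> \oo] --> 0.
Proof.
have : (\int[G]_y (cutoff n%:R y)%:E)%E @[n --> \oo] --> (\int[G]_y 0)%E.
  apply: (@dominated_cvg _ _ _ _ _ measurableT _ _ (cst 1%E)) => //.
  - by move=> n; apply/measurable_EFinP; exact: measurable_cutoff.
  - move=> y _; apply: cvg_near_cst; near=> n.
    have hn : \sum_u `|y u| <= n%:R by near: n; exact: nbhs_infty_ger.
    rewrite cutoff_eq0// => u; apply: le_trans hn.
    by rewrite (bigD1 u)//= lerDl sumr_ge0.
  - by apply: (@finite_measure_integrable_cst _ _ _ _ _ 1).
  - move=> n y _; have /andP[h1 h2] := cutoff_bounds n%:R y.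
    by rewrite gee0_abs lee_fin.
rewrite integral0 => /fine_cvg; exact.
Unshelve. all: by end_near. Qed.

End cutoff.

Section extended_weak_convergence.
Context (R : realType) (V : finType) (A : {set V}).
Context (I : Type) (F : set_system I) (FF : ProperFilter F).
Context d (T : measurableType d) (mu : I -> {measure set T -> \bar R}).
Hypothesis mu1 : forall i, mu i setT = 1%E.
Variables (tau : I -> T -> vec R A) (G : probability (vec R A) R).
Hypothesis mtau : forall i, measurable_fun setT (tau i).
Hypothesis cvg_mu : forall f : vec R A -> R, bounded_continuous f ->
  \int[mu i]_x f (tau i x) @[i --> F] --> \int[G]_y f y.

(* On a large box [g i] is uniformly close to [g0] by compactness, and outside of
   it [|g i - g0| <= B * cutoff], whose integrals converge to a small limit. *)
Lemma cvg_Rintegral_joint (g : I -> vec R A -> R) (g0 : vec R A -> R) (B : R) :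
  (forall i, measurable_fun setT (g i)) -> (forall i y, 0 <= g i y <= B) ->
  (forall y0, g p.1 p.2 @[p --> filter_prod F (nbhs y0)] --> g0 y0) ->
  \int[mu i]_x g i (tau i x) @[i --> F] --> \int[G]_y g0 y.
Proof.
move=> mg gB gg0.
have cg0 : continuous g0 by exact: (@joint_cvg_continuous R I F).
have mg0 : measurable_fun setT g0.
  by apply: discretizable_continuous_measurable => //; exact: discretizable_vec.
have g0B y : 0 <= g0 y <= B.
  have gy : g i y @[i --> F] --> g0 y.
    apply: (cvg_comp (fun i => (i, y)) (fun p => g p.1 p.2) _ (gg0 y)).
    move=> W [[U N]/= [FU nN] UN]; apply: filterS FU => j Uj.
    by apply: (UN (j, y)); split=> //; exact: nbhs_singleton.
  apply/andP; split.
    rewrite -(cvg_lim _ gy)//; apply: limr_ge; first by apply/cvg_ex; exists (g0 y).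
    by near=> i; have /andP[] := gB i y.
  rewrite -(cvg_lim _ gy)//; apply: limr_le; first by apply/cvg_ex; exists (g0 y).
  by near=> i; have /andP[] := gB i y.
have B0 : 0 <= B by have /andP[/le_trans] := g0B (fun=> 0); apply.
apply/cvgrPdist_le => e e0.
(* The error is [e'] for the weak convergence tested on [g0], [e'] on the box and [B * (e' * 2)] off
   it: the cutoff has [G]-integral below [e'], hence eventually [mu i]-integral below twice that. *)
pose e' := e / (2 + B * 2).
have e'0 : 0 < e' by rewrite divr_gt0// ltr_wpDr// mulr_ge0.
have /cvgrPdist_lt/(_ _ e'0)/filter_ex [M hM] := @cvg_cutoff R V A G.
have c_bc : bounded_continuous (@cutoff R V A M%:R).
  split; first exact: continuous_cutoff.
  exists 1 => x; have /andP[h1 h2] := cutoff_bounds M%:R x.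
  by rewrite ger0_norm.
have g_bc : bounded_continuous g0.
  split=> //; exists B => x; have /andP[h1 h2] := g0B x.
  by rewrite ger0_norm.
have /cvgrPdist_lt/(_ _ e'0) H1 := cvg_mu c_bc.
have /cvgrPdist_le/(_ _ e'0) H2 := cvg_mu g_bc.
(* Compactness in its near-covering form: each point of the box has a product neighbourhood, where
   the continuity of [g0] moves the comparison from the centre [y] to the nearby [t]. *)
have H3 : \near F, box (fun=> 0) (M%:R + 1) `<=` (fun y => `|g F y - g0 y| <= e').
  have /compact_near_coveringP := @compact_box R V A (fun=> 0) (M%:R + 1).
  apply => y _.
  have e'20 : 0 < e' / 2 by rewrite divr_gt0.
  have /cvgrPdist_le/(_ _ e'20) [[U W]/= [FU nW] UW] := gg0 y.
  have /cvgrPdist_le/(_ _ e'20) hc := cg0 y.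
  exists (W `&` (fun t => `|g0 y - g0 t| <= e' / 2), U) => /=.
    by split=> //; exact: filterI.
  move=> [t i]/= [[Wt ht] Ui].
  have h1 := UW (i, t) (conj Ui Wt).
  rewrite (splitr e') (le_trans _ (lerD h1 ht))// -[X in _ <= X + _]normrN opprB.
  by rewrite (le_trans _ (ler_normD _ _))//= addrA subrK.
near=> i.
have h1 : `|\int[G]_y cutoff M%:R y - \int[mu i]_x cutoff M%:R (tau i x)| < e'.
  by near: i.
have h2 : `|\int[G]_y g0 y - \int[mu i]_x g0 (tau i x)| <= e' by near: i.
have h3 : box (fun=> 0) (M%:R + 1) `<=` (fun y => `|g i y - g0 y| <= e').
  by near: i.
have mcomp (f : vec R A -> R) : measurable_fun setT f ->
    measurable_fun setT (fun x => f (tau i x)).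
  by move=> mf; exact: measurableT_comp.
have intg : (mu i).-integrable setT (EFin \o (fun x => g i (tau i x))).
  apply: (@integrable_bounded _ _ _ _ (mu1 i) _ B); first exact: mcomp.
  by move=> x; have /andP[? ?] := gB i (tau i x); rewrite ger0_norm.
have intg0 : (mu i).-integrable setT (EFin \o (fun x => g0 (tau i x))).
  apply: (@integrable_bounded _ _ _ _ (mu1 i) _ B); first exact: mcomp.
  by move=> x; have /andP[? ?] := g0B (tau i x); rewrite ger0_norm.
have intc : (mu i).-integrable setT (EFin \o (fun x => cutoff M%:R (tau i x))).
  apply: (@integrable_bounded _ _ _ _ (mu1 i) _ 1).
    by apply: mcomp; exact: measurable_cutoff.
  by move=> x; have /andP[? ?] := cutoff_bounds M%:R (tau i x); rewrite ger0_norm.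
have intBc : (mu i).-integrable setT (EFin \o (fun x => B * cutoff M%:R (tau i x))).
  apply: (@integrable_between _ _ _ _ (mu1 i) _ 0 B).
    by apply: (mcomp (fun y => B * _)); apply: measurable_funM => //;
      exact: measurable_cutoff.
  move=> x; have /andP[? ?] := cutoff_bounds M%:R (tau i x).
  by rewrite mulr_ge0//= ler_piMr.
have intcst : (mu i).-integrable setT (EFin \o (fun=> e')).
  by apply: (@integrable_bounded _ _ _ _ (mu1 i) _ `|e'|).
have h4 : `|\int[mu i]_x g i (tau i x) - \int[mu i]_x g0 (tau i x)|
    <= e' + B * (e' * 2).
  have intB : (mu i).-integrable setT
      (EFin \o (fun x => g i (tau i x) - g0 (tau i x))).
    apply: (@integrable_between _ _ _ _ (mu1 i) _ (- B) B).
      by apply: measurable_funB; exact: mcomp.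
    move=> x; have /andP[? ?] := gB i (tau i x).
    by have /andP[? ?] := g0B (tau i x); apply/andP; split; lra.
  rewrite -RintegralB//; apply: (le_trans (le_normr_Rintegral _ _)) => //.
  apply: (@le_trans _ _ (\int[mu i]_x (e' + B * cutoff M%:R (tau i x)))).
    apply: le_Rintegral => //.
    - exact: integrable_norm intB.
    - exact: integrableD intcst intBc.
    move=> x _; have [xb|xb] := pselect (box (fun=> 0) (M%:R + 1) (tau i x)).
      rewrite (le_trans (h3 _ xb))// lerDl mulr_ge0//.
      by have /andP[] := cutoff_bounds M%:R (tau i x).
    rewrite cutoff_out// mulr1 ler_norml.
    have /andP[? ?] := gB i (tau i x).
    have /andP[? ?] := g0B (tau i x).
    have := ltW e'0; lra.
  rewrite RintegralD// Rintegral_prob_cst// RintegralZl// lerD2l ler_wpM2l//.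
  rewrite sub0r normrN in hM.
  move: h1; rewrite ltr_norml => /andP[h1 _].
  have := le_lt_trans (ler_norm _) hM; lra.
have eE : e = e' + (e' + B * (e' * 2)).
  by rewrite /e'; field; rewrite gt_eqF// ltr_wpDr// mulr_ge0.
rewrite eE -(subrK (\int[mu i]_x g0 (tau i x)) (\int[G]_y g0 y)) -addrA.
by rewrite (le_trans (ler_normD _ _))// lerD// distrC.
Unshelve. all: by end_near. Qed.

End extended_weak_convergence.

(** * Kernels and conditional laws *)

(* Measurability of the function cannot be inferred by unification, hence the
   explicit instance. *)
Local Notation pushforward_measure :=
  measure_function_pushforward__canonical__measure_function_Measure.

Section kernel_graph.
Context (R : realType) d d' d'' (T : measurableType d) (X : measurableType d')
  (Y : measurableType d'') (K : R.-pker X ~> Y) (x : T -> X).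
Hypothesis mx : measurable_fun setT x.

(** The measurability proof is an argument so that the kernel instances below can be attached to the
    term [kpull mx]. *)
Definition kpull of measurable_fun setT x : T -> {measure set Y -> \bar R} :=
  fun t => K (x t).

Let measurable_kpull (U : set Y) : measurable U ->
  measurable_fun setT (kpull mx ^~ U).
Proof. by move=> mU; exact: (measurableT_comp (measurable_kernel K U mU) mx). Qed.

HB.instance Definition _ := isKernel.Build _ _ _ _ _ (kpull mx) measurable_kpull.

Let kpull_prob t : kpull mx t setT = 1%E.
Proof. exact: prob_kernel. Qed.

HB.instance Definition _ :=
  Kernel_isProbability.Build _ _ _ _ _ (kpull mx) kpull_prob.

Lemma measurable_integral_kpull (f : T * Y -> \bar R) :
  measurable_fun setT f -> (forall p, 0 <= f p)%E ->
  measurable_fun setT (fun t => \int[K (x t)]_y f (t, y))%E.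
Proof.
move=> mf f0; exact: (measurable_fun_integral_finite_kernel f (kpull mx)).
Qed.

End kernel_graph.

Section conditional_law.
Context (R : realType) dO (Omega : measurableType dO) (P : probability Omega R).
Context d d' d'' (T : measurableType d) (X : measurableType d')
  (Y : measurableType d'') (K : R.-pker X ~> Y) (x : T -> X).
Hypothesis mx : measurable_fun setT x.
Variables (W : Omega -> T) (Z : Omega -> Y).
Hypotheses (mW : measurable_fun setT W) (mZ : measurable_fun setT Z).
Hypothesis condK : forall B, measurable B ->
  is_cond_prob P W (Z @^-1` B) (fun w => K (x (W w)) B).

Let pair_at (p : unit * Omega) (y : Y) : T * Y := (W p.2, y).

Let measurable_pair_at p : measurable_fun setT (pair_at p).
Proof. exact: measurable_fun_pair. Qed.

Let k (p : unit * Omega) : {measure set (T * Y) -> \bar R} :=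
  pushforward_measure
    (K (x (W p.2))) (measurable_pair_at p).

Let measurable_k (U : set (T * Y)) : measurable U ->
  measurable_fun setT (k ^~ U).
Proof.
move=> mU.
have mxW : measurable_fun setT (fun p : unit * Omega => x (W p.2)).
  by apply: measurableT_comp => //; exact: measurableT_comp.
have := @measurable_integral_kpull R _ _ _ _ _ _ K _ mxW
  (fun q => (\1_U (W q.1.2, q.2))%:E).
have mg : measurable_fun setT (fun q : (unit * Omega) * Y => (W q.1.2, q.2)).
  apply: measurable_fun_pair => //; apply: measurableT_comp => //.
  exact: measurableT_comp.
move=> h; rewrite (_ : (fun p => k p U) =
    (fun p => \int[K (x (W p.2))]_y (\1_U (W p.2, y))%:E)%E).
  apply: h => [|p]; last by rewrite lee_fin.
  by apply/measurable_EFinP; exact: (measurableT_comp (measurable_indic mU) mg).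
apply/funext => p.
have mpU : measurable (pair_at p @^-1` U).
  by rewrite -[_ @^-1` _]setTI; exact: measurable_pair_at.
have := @integral_indic _ _ _ (K (x (W p.2))) _ measurableT _ mpU.
by rewrite setIT => /esym; exact.
Qed.

Let k1 p : k p setT = 1%E.
Proof. exact: (@prob_kernel _ _ _ _ _ K (x (W p.2))). Qed.

HB.instance Definition _ := isKernel.Build _ _ _ _ _ k measurable_k.
HB.instance Definition _ := Kernel_isProbability.Build _ _ _ _ _ k k1.

(** A one-point source turns [P] into a kernel, so that the mixture of [k] over [P] is a composite
    of kernels and thereby a measure. *)
Let l := kprobability
  (measurable_cst (P : pprobability Omega R) : measurable_fun [set: unit] _).

(** Both sides are integrals against measures on pairs that agree on measurable rectangles, which is
    the defining property of conditional probability. The map [x] is there because [W] will hold all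
    earlier vertices while the kernel reads only the separator. *)
Lemma integral_cond_law (f : T * Y -> \bar R) :
  measurable_fun setT f -> (forall p, 0 <= f p)%E ->
  (\int[P]_w f (W w, Z w) = \int[P]_w \int[K (x (W w))]_y f (W w, y))%E.
Proof.
move=> mf f0.
pose WZ w := (W w, Z w).
have mWZ : measurable_fun setT WZ by exact: measurable_fun_pair.
pose m1 := pushforward_measure P mWZ.
pose m2 : {measure set (T * Y) -> \bar R} := mkcomp l k tt.
have m12 A : measurable A -> m1 A = m2 A.
  apply: (measure_unique
    [set A `*` B | A in measurable & B in measurable] (fun=> setT)).
  - exact: measurable_prod_measurableType.
  - move=> _ _ [A1 mA1 [B1 mB1 <-]] [A2 mA2 [B2 mB2 <-]].
    by rewrite -setXI; exists (A1 `&` A2); [exact: measurableI|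
      exists (B1 `&` B2) => //; exact: measurableI].
  - by move=> _; exists setT => //; exists setT => //; rewrite setXTT.
  - by rewrite bigcup_const//; exists 0%N.
  - move=> _ [A1 mA1 [B1 mB1 <-]].
    rewrite [LHS](_ : _ = P (Z @^-1` B1 `&` W @^-1` A1)); last first.
      by congr (P _); apply/seteqP; split=> w /= [].
    have [_ /(_ _ mA1) <-] := condK mB1.
    rewrite integral_mkcond [RHS](_ : _ = \int[P]_w K (x (W w))
      (pair_at (tt, w) @^-1` (A1 `*` B1)))%E//.
    apply: eq_integral => w _; rewrite patchE.
    case: ifPn => [/set_mem wA|/negP wA].
      rewrite (_ : pair_at (tt, w) @^-1` (A1 `*` B1) = B1)//.
      by apply/seteqP; split=> y //= [].
    rewrite (_ : pair_at (tt, w) @^-1` (A1 `*` B1) = set0) ?measure0//.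
    by apply/seteqP; split=> y //= [wA' _]; apply: wA; apply/mem_set.
  - by move=> _; rewrite /m1 /pushforward/= /pushforward preimage_setT
      probability_setT ltry.
transitivity (\int[m1]_p f p)%E.
  by rewrite ge0_integral_pushforward.
rewrite (@eq_measure_integral _ _ _ _ m2)//; last by move=> A mA _; exact: m12.
rewrite [LHS]integral_kcomp//.
apply: eq_integral => w _.
by rewrite ge0_integral_pushforward.
Qed.

End conditional_law.

(** * Conditioning on an exceedance *)

Lemma eq_law_given (R : realType) dO (Omega : measurableType dO)
    (P : probability Omega R) d (T : measurableType d) (D : set Omega)
    (Y1 Y2 : Omega -> T) : (forall w, D w -> Y1 w = Y2 w) ->
  law_given P D Y1 = law_given P D Y2.
Proof.
move=> Y12; apply/funext => B; rewrite /law_given.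
suff -> : D `&` Y1 @^-1` B = D `&` Y2 @^-1` B by [].
by apply/seteqP; split=> w /= [Dw]; rewrite Y12.
Qed.

Section law_given_integral.
Context (R : realType) dO (Omega : measurableType dO) (P : probability Omega R).
Context d (T : measurableType d) (D : set Omega) (Y : Omega -> T).
Hypotheses (mD : measurable D) (mY : measurable_fun setT Y).

Lemma ge0_integral_mrestr (f : Omega -> \bar R) :
  measurable_fun setT f -> (forall w, 0 <= f w)%E ->
  (\int[mrestr P mD]_w f w = \int[P]_(w in D) f w)%E.
Proof.
move=> mf f0; rewrite -(setUv D) ge0_integral_setU//.
- rewrite (@eq_measure_integral _ _ _ D P)//; last first.
    by move=> A mA AD; rewrite /= /mrestr (setIidl AD).
  rewrite (@eq_measure_integral _ _ _ (~` D) mzero)//; last first.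
    move=> A mA AD; rewrite /= /mrestr /mzero.
    have -> : A `&` D = set0 by apply/seteqP; split=> w // [/AD].
    by rewrite measure0.
  by rewrite integral_measure_zero adde0.
- exact: measurableC.
- by apply: measurable_funTS; exact: mf.
- exact/disj_setPCl.
Qed.

Let PD_ge0 : 0 <= (fine (P D))^-1.
Proof. by rewrite invr_ge0 fine_ge0. Qed.

(** [law_given] is a bare set function; its agreement on measurable sets with this rescaled image of
    the restriction of [P] to [D] gives it a measure structure. *)
Let m : {measure set T -> \bar R} := mscale (NngNum PD_ge0)
  (pushforward_measure
    (mrestr P mD) mY).

Let law_givenE B : measurable B -> law_given P D Y B = m B.
Proof.
move=> mB; have mYB : measurable (Y @^-1` B) by rewrite -[_ @^-1` _]setTI; exact: mY.
rewrite /law_given /m /= /mscale /= /pushforward /mrestr setIC EFinM muleC fineK//.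
by apply: fin_num_measure; exact: measurableI.
Qed.

Let law_given0 : law_given P D Y set0 = 0%E.
Proof. by rewrite law_givenE// measure0. Qed.

Let law_given_ge0 B : (0 <= law_given P D Y B)%E.
Proof. by rewrite lee_fin divr_ge0// fine_ge0. Qed.

Let law_given_additive : semi_sigma_additive (law_given P D Y).
Proof.
move=> F mF tF mUF; rewrite law_givenE//.
rewrite (_ : (fun n => _) = (fun n => \sum_(0 <= i < n) m (F i)))%E.
  exact: measure_semi_sigma_additive.
by apply/funext => n; apply: eq_bigr => i _; rewrite law_givenE.
Qed.

HB.instance Definition _ := isMeasure.Build _ _ _ (law_given P D Y)
  law_given0 law_given_ge0 law_given_additive.

Lemma ge0_integral_law_given (f : T -> \bar R) :
  measurable_fun setT f -> (forall y, 0 <= f y)%E ->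
  (\int[law_given P D Y]_y f y
    = (fine (P D))^-1%:E * \int[P]_(w in D) f (Y w))%E.
Proof.
move=> mf f0; rewrite (@eq_measure_integral _ _ _ setT m)//; last first.
  by move=> A mA _; exact: law_givenE.
rewrite /m ge0_integral_mscale// ge0_integral_pushforward//.
congr (_ * _)%E; rewrite preimage_setT ge0_integral_mrestr//.
  exact: measurableT_comp.
by move=> w; exact: f0.
Qed.

Lemma law_given_setT : P D != 0%E -> law_given P D Y setT = 1%E.
Proof.
move=> PD0; rewrite /law_given preimage_setT setIT divff// fine_eq0//.
exact: fin_num_measure.
Qed.

Lemma Rintegral_law_given_shift (f : T -> R) (M : R) : P D != 0%E ->
  measurable_fun setT f -> (forall y, `|f y| <= M) ->
  fine (\int[law_given P D Y]_y (f y)%:E)%E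
    = fine (\int[law_given P D Y]_y (f y + M)%:E)%E - M.
Proof. by move=> /law_given_setT law1; exact: Rintegral_shift. Qed.

End law_given_integral.

Section memoryless.
Context (R : realType) dO (Omega : measurableType dO) (P : probability Omega R).
Variable Y : {RV P >-> R}.
Hypothesis expY : unit_exponential Y.

Lemma exponential_tail y : P [set w | y < Y w] = (Num.min (expR (- y)) 1)%:E.
Proof.
have := @cdf_ccdf_1 _ _ _ P Y y; rewrite expY.
rewrite (_ : ccdf Y y = P [set w | y < Y w]); last first.
  rewrite /ccdf /distribution /pushforward; congr (P _).
  by apply/seteqP; split=> w /=; rewrite in_itv/= andbT.
have : P [set w | y < Y w] \is a fin_num.
  apply: fin_num_measure; rewrite (_ : [set _ | _] = Y @^-1` `]y, +oo[).
    by rewrite -[_ @^-1` _]setTI; exact: measurable_funP.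
  by apply/seteqP; split=> w /=; rewrite in_itv/= andbT.
move=> /fineK <-; rewrite -EFinD => -[h]; congr EFin.
move: h; set p := fine _; rewrite /Num.max /Num.min.
by case: ltP => h1; case: ltP => h2; lra.
Qed.

Lemma measurable_gt t : measurable [set w | t < Y w].
Proof.
rewrite (_ : [set _ | _] = Y @^-1` `]t, +oo[).
  by rewrite -[_ @^-1` _]setTI; exact: measurable_funP.
by apply/seteqP; split=> w /=; rewrite in_itv/= andbT.
Qed.

(** It suffices to compare the two measures on the half-lines above x, a generating pi-system. For
    [0 <= x] both give exp(-t-x); for [x < 0] the event reduces to [t < Y] and both give exp(-t). *)
Lemma memoryless (t : R) (g : R -> \bar R) : 0 <= t ->
  measurable_fun setT g -> (forall y, 0 <= g y)%E ->
  (\int[P]_(w in [set w | (t < Y w)%R]) g (Y w - t)%R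
    = (expR (- t))%:E * \int[P]_w g (Y w))%E.
Proof.
move=> t0 mg g0.
pose D := [set w | t < Y w].
have mD : measurable D by exact: measurable_gt.
have mYt : measurable_fun setT (fun w => Y w - t) by exact: measurable_funB.
have mY : measurable_fun setT (Y : Omega -> R) by [].
have PD : P D = (expR (- t))%:E.
  by rewrite exponential_tail min_l// -expR0 ler_expR oppr_le0.
rewrite -(ge0_integral_mrestr P mD) //; last exact: measurableT_comp.
pose m1 := pushforward_measure
  (mrestr P mD) mYt.
pose m2 : {measure set R -> \bar R} := mscale (NngNum (expR_ge0 (- t)))
  (pushforward_measure P mY).
transitivity (\int[m1]_y g y)%E; first by rewrite ge0_integral_pushforward.
rewrite (@eq_measure_integral _ _ _ _ m2).
  by rewrite ge0_integral_mscale// ge0_integral_pushforward.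
move=> A mA _.
apply: (measure_unique (@RGenOInfty.G R) (fun k => `]- k%:R, +oo[%classic)).
- exact: RGenOInfty.measurableE.
- move=> _ _ [x1 ->] [x2 ->]; exists (Num.max x1 x2).
  by apply/seteqP; split=> x /=; rewrite !in_itv/= !andbT gt_max => /andP.
- by move=> k; exists (- k%:R).
- apply/seteqP; split=> x // _; exists (Num.bound `|x : R|) => //=.
  rewrite in_itv/= andbT ltrNl (le_lt_trans (ler_norm _))// normrN.
  exact: archi_boundP (normr_ge0 _).
- move=> _ [x ->].
  rewrite [RHS](_ : _ = (expR (- t))%:E * P [set w | (x < Y w)%R])%E; last first.
    congr (_ * P _)%E; apply/seteqP; split=> w /=; by rewrite in_itv/= andbT.
  rewrite [LHS](_ : _ = P [set w | Num.max t (t + x) < Y w]); last first.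
    congr (P _); apply/seteqP; split=> w /=; rewrite in_itv/= andbT gt_max.
      by move=> [h1 h2]; apply/andP; split=> //; lra.
    by move=> /andP[h1 h2]; split=> //; lra.
  rewrite !exponential_tail -EFinM; congr EFin.
  have e0 := expR_gt0 (- t).
  have [x0|x0] := leP 0 x.
    rewrite max_r ?lerDl// !min_l -?expR0 ?ler_expR ?oppr_le0 ?addr_ge0//.
    by rewrite opprD expRD.
  rewrite max_l ?gerDl ?ltW// min_l -?expR0 ?ler_expR ?oppr_le0//.
  by rewrite min_r ?expR0 ?mulr1// -expR0 ler_expR oppr_ge0 ltW.
- move=> k; rewrite /m1 /= /pushforward /mrestr.
  apply: (@le_lt_trans _ _ (P D)); last by rewrite PD ltry.
  have mYk : measurable ((fun w => Y w - t) @^-1` `]- k%:R, +oo[).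
    by rewrite -[_ @^-1` _]setTI; exact: (mYt measurableT).
  apply: le_measure; [rewrite inE; exact: measurableI|by rewrite inE|].
  exact: subIsetr.
- exact: mA.
Qed.

End memoryless.

(** * One step of the clique recursion *)

Section states.
Context (R : realType) (V : finType).
Local Notation full := (vec R [set: V]%SET).
Implicit Types (A : {set V}) (z : full).

(** States live in R^V for every clique, so that the operators compose on one type instead of on R^A
    for a growing set A; [entry] hides the membership proof. *)
Definition entry z (u : V) : R := z (exist _ u (finset.in_setT u)).

Definition upd A z (y : vec R A) : full :=
  subvec [set: V]%SET (fun u => oapp y (entry z u) (insub u)).

Definition slice A z : vec R A := subvec A (entry z).
Arguments slice A z : clear implicits.

Lemma entry_subvec (x : V -> R) u : entry (subvec [set: V]%SET x) u = x u.
Proof. by []. Qed.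

Lemma state_eq z z' : (forall u, entry z u = entry z' u) -> z = z'.
Proof.
move=> h; apply/funext => -[u uT]; have := h u.
by rewrite /entry (bool_irrelevance uT (finset.in_setT u)).
Qed.

Lemma entry_upd_in A z (y : vec R A) u : entry (upd z y) (val u) = y u.
Proof. by rewrite entry_subvec valK. Qed.

Lemma entry_upd_out A z (y : vec R A) u : u \notin A -> entry (upd z y) u = entry z u.
Proof. by move=> uA; rewrite entry_subvec insubN. Qed.

Lemma measurable_entry u : measurable_fun setT (fun z : full => entry z u).
Proof. exact: measurable_vec_proj. Qed.

Lemma measurable_subvec d (T : measurableType d) A (f : T -> V -> R) :
  (forall u, u \in A -> measurable_fun setT (fun x => f x u)) ->
  measurable_fun setT (fun x => subvec A (f x)).
Proof. by move=> mf; apply: measurable_vec => // -[u uA]; exact: mf. Qed.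

Lemma measurable_slice A : measurable_fun setT (@slice A).
Proof. by apply: measurable_subvec => u _; exact: measurable_entry. Qed.

Lemma measurable_upd d (T : measurableType d) A (f : T -> full) (g : T -> vec R A) :
  measurable_fun setT f -> measurable_fun setT g ->
  measurable_fun setT (fun x => upd (f x) (g x)).
Proof.
move=> mf mg; apply: measurable_subvec => u _; case: insubP => [w _ _|_] /=.
  exact: (measurableT_comp (measurable_vec_proj w) mg).
exact: (measurableT_comp (measurable_entry u) mf).
Qed.

Lemma cvg_slice (I : Type) (F : set_system I) (FF : Filter F) A
    (f : I -> full) z : f i @[i --> F] --> z ->
  slice A (f i) @[i --> F] --> slice A z.
Proof. by move=> fz; apply: cvg_vec => u; exact: cvg_proj fz. Qed.

Lemma cvg_upd (I : Type) (F : set_system I) (FF : Filter F) A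
    (f : I -> full) (g : I -> vec R A) z (y : vec R A) :
  f i @[i --> F] --> z -> g i @[i --> F] --> y ->
  upd (f i) (g i) @[i --> F] --> upd z y.
Proof.
move=> fz gy; apply: cvg_vec => -[u uT]; rewrite /upd /subvec /=.
case: insubP => [w _ _|_] /=; first exact: cvg_proj gy.
exact: cvg_proj fz.
Qed.

End states.
Arguments slice {R V} A z.

Lemma measurable_fun_invr (R : realType) d (T : measurableType d) (f : T -> R) :
  measurable_fun setT f -> (forall x, 0 < f x) ->
  measurable_fun setT (fun x => (f x)^-1).
Proof.
move=> mf f0; rewrite (_ : (fun x => _) = (fun x => expR (- ln (f x)))).
  apply: (measurableT_comp (@measurable_expR R)).
  by apply: measurable_funN; exact: (measurableT_comp (@measurable_ln R) mf).
by apply/funext => x; rewrite expRN lnK// posrE.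
Qed.

Section one_step.
Context (R : realType) (V : finType) (S D : {set V}).
Local Notation full := (vec R [set: V]%SET).
Context (K : R.-pker (vec R S) ~> (vec R D)) (G : probability (vec R D) R).
Context (a b : R -> V -> R) (aS bS psi phi : vec R S -> vec R D).

Definition kstep (s : R) (h : full -> R) (z : full) : R :=
  \int[K (destandardize a b (slice S z) s)]_y
    h (upd z (standardize (subvec D (a s)) (subvec D (b s)) y)).

Definition lstep (h : full -> R) (z : full) : R :=
  \int[G]_y h (upd z (fun u => psi (slice S z) u + phi (slice S z) u * y u)).

(* Locally uniform convergence to a continuous limit, as convergence along a
   product filter. *)
Definition joint_cvg (h : R -> full -> R) (h0 : full -> R) : Prop :=
  forall z0, h p.1 p.2 @[p --> filter_prod (pinfty_nbhs R) (nbhs z0)] --> h0 z0.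

(** The filter is abstract to cover two regimes: a product filter at [z0] for the later cliques, and
    for the root a state fixed at the origin with only the level moving. *)
Lemma cvg_kstep (F : set_system (R * full)) (FF : ProperFilter F) (z0 : full)
    (h : R -> full -> R) (h0 : full -> R) (B : R) :
  (forall s, measurable_fun setT (h s)) -> (forall s z, 0 <= h s z <= B) ->
  joint_cvg h h0 ->
  p.1 @[p --> F] --> +oo -> p.2 @[p --> F] --> z0 ->
  let x p := destandardize a b (slice S p.2) p.1 in
  (forall f : vec R D -> R, bounded_continuous f ->
    \int[K (x p)]_y f (standardize (aS (x p)) (bS (x p)) y) @[p --> F]
      --> \int[G]_y f y) ->
  (forall u, (aS (x p) u - a p.1 (val u)) / b p.1 (val u) @[p --> F]
     --> psi (slice S z0) u) ->
  (forall u, bS (x p) u / b p.1 (val u) @[p --> F] --> phi (slice S z0) u) ->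
  (\forall p \near F, forall u, bS (x p) u != 0) ->
  kstep p.1 (h p.1) p.2 @[p --> F] --> lstep h0 z0.
Proof.
move=> mh hB hh0 F1 F2 x Kcvg acvg bcvg bS0.
(* Since (y - a)/b = (aS - a)/b + (bS/b) (y - aS)/bS, this is the integrand of [kstep] as a function
   of the variable standardized by the kernel's own normings, for which weak convergence is
   known. *)
pose g (p : R * full) (y : vec R D) : R := h p.1 (upd p.2
  (fun u => (aS (x p) u - a p.1 (val u)) / b p.1 (val u) +
            bS (x p) u / b p.1 (val u) * y u)).
pose g0 (y : vec R D) : R :=
  h0 (upd z0 (fun u => psi (slice S z0) u + phi (slice S z0) u * y u)).
have : \int[K (x p)]_y g p (standardize (aS (x p)) (bS (x p)) y) @[p --> F]
    --> \int[G]_y g0 y.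
  apply: (@cvg_Rintegral_joint R V D _ F FF _ _ (fun p => K (x p)) _
    (fun p => standardize (aS (x p)) (bS (x p))) G _ _ g g0 B) => //.
  - by move=> p; exact: prob_kernel.
  - by move=> p; exact: measurable_standardize.
  - move=> p; apply: measurableT_comp; first exact: mh.
    apply: measurable_upd => //; apply: measurable_vec => // u.
    apply: measurable_funD => //; apply: measurable_funM => //.
    exact: measurable_vec_proj.
  - by move=> p y; exact: hB.
  - move=> y0.
    apply: (cvg_comp (fun q : (R * full) * vec R D => (q.1.1, upd q.1.2
      (fun u => (aS (x q.1) u - a q.1.1 (val u)) / b q.1.1 (val u) +
         bS (x q.1) u / b q.1.1 (val u) * q.2 u)))
      (fun p => h p.1 p.2) _ (hh0 _)).
    have Q1 : q.1 @[q --> filter_prod F (nbhs y0)] --> F by exact: cvg_fst.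
    have Q2 : q.2 @[q --> filter_prod F (nbhs y0)] --> y0 by exact: cvg_snd.
    apply: (@cvg_pair _ _ _ (filter_prod F (nbhs y0)) (pinfty_nbhs R)
      (nbhs (upd z0 (fun u => psi (slice S z0) u + phi (slice S z0) u * y0 u)))).
      exact: (cvg_comp _ _ Q1 F1).
    apply: cvg_upd; first exact: (cvg_comp _ _ Q1 F2).
    apply: cvg_vec => u; apply: cvgD; first exact: (cvg_comp _ _ Q1 (acvg u)).
    apply: cvgM; first exact: (cvg_comp _ _ Q1 (bcvg u)).
    exact: cvg_proj Q2.
apply: cvg_trans; apply: near_eq_cvg; near=> p.
have bp : forall u, bS (x p) u != 0 by near: p.
rewrite /kstep; apply: eq_Rintegral => y _; rewrite /g; congr (h _ (upd _ _)).
apply/funext => u; rewrite /standardize /subvec.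
have := bp u; move: (bS _ u) (aS _ u) (b _ _)^-1 => c e w c0.
by field.
Unshelve. all: by end_near. Qed.

Lemma lstep_bounds (h : full -> R) (B : R) : measurable_fun setT h ->
  (forall z, 0 <= h z <= B) -> forall z, 0 <= lstep h z <= B.
Proof.
move=> mh hB z; apply: Rintegral_bounds => //; first exact: probability_setT.
apply: measurableT_comp => //; apply: measurable_upd => //.
apply: measurable_vec => // u; apply: measurable_funD => //.
by apply: measurable_funM => //; exact: measurable_vec_proj.
Qed.

Lemma kstep_bounds s (h : full -> R) (B : R) : measurable_fun setT h ->
  (forall z, 0 <= h z <= B) -> forall z, 0 <= kstep s h z <= B.
Proof.
move=> mh hB z; apply: Rintegral_bounds => //; first exact: prob_kernel.
apply: measurableT_comp => //; apply: measurable_upd => //.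
exact: measurable_standardize.
Qed.

(** Measurability in the pair is required because the level is eventually replaced by the random
    X_v. *)
Lemma measurable_kstep (f : R * full -> R) (B : R) :
  (forall u, measurable_fun setT (a ^~ u)) ->
  (forall u, measurable_fun setT (b ^~ u)) -> (forall t u, 0 < b t u) ->
  measurable_fun setT f -> (forall p, 0 <= f p <= B) ->
  measurable_fun setT (fun p : R * full => kstep p.1 (fun z => f (p.1, z)) p.2).
Proof.
move=> ma mb b_gt0 mf fB.
pose x (p : R * full) := destandardize a b (slice S p.2) p.1.
have mx : measurable_fun setT x.
  apply: measurable_vec => // u; apply: measurable_funD.
    exact: (measurableT_comp (ma _)).
  apply: measurable_funM; first exact: (measurableT_comp (mb _)).
  exact: (measurableT_comp (measurable_entry _)).
apply: (measurableT_comp (fine_measurable _ )) => //.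
apply: (measurable_integral_kpull K mx (f := fun q => (f (q.1.1, upd q.1.2
  (standardize (subvec D (a q.1.1)) (subvec D (b q.1.1)) q.2)))%:E)) => //.
  apply/measurable_EFinP; apply: measurableT_comp => //.
  have m11 : measurable_fun setT (fun q : (R * full) * vec R D => q.1.1).
    exact: measurableT_comp.
  apply: measurable_fun_pair => //; apply: measurable_upd.
    exact: measurableT_comp.
  apply: measurable_vec => // u; apply: measurable_funM.
    apply: measurable_funB; last exact: (measurableT_comp (ma _) m11).
    exact: (measurableT_comp (measurable_vec_proj u)).
  apply: measurable_fun_invr; last by move=> q; exact: b_gt0.
  exact: (measurableT_comp (mb _) m11).
by move=> p; rewrite lee_fin; have /andP[] := fB (p.1.1, upd p.1.2
  (standardize (subvec D (a p.1.1)) (subvec D (b p.1.1)) p.2)).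
Qed.

End one_step.

(** * Convergence of the clique operators under the assumptions *)

Section uniform_to_joint.
Context (R : realType) (V : finType) (S : {set V}).

(** The box of radius 1 is both compact and a neighbourhood of [z0], so uniformity on it controls
    the product filter. *)
Lemma family_compact_joint (f : R -> vec R S -> R) (l : R) (z0 : vec R S) :
  {family compact, f @ +oo --> (fun=> l)} ->
  f p.1 p.2 @[p --> filter_prod (pinfty_nbhs R) (nbhs z0)] --> l.
Proof.
move=> /fam_cvgP/(_ (box z0 1) (@compact_box _ _ _ _ _)) fl.
apply/cvgrPdist_lt => e e0.
have h : \forall t \near +oo, forall z, box z0 1 z -> `|l - f t z| < e.
  apply: (fl [set g | forall z, box z0 1 z -> `|l - g z| < e]).
  apply/uniform_nbhs; exists [set xy | `|xy.1 - xy.2| < e]; split.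
    exact: (@entourage_ball _ _ (PosNum e0)).
  by move=> g /= gl z zb; exact: gl.
exists ([set t | forall z, box z0 1 z -> `|l - f t z| < e], box z0 1) => /=.
  by split=> //; exact: nbhs_box.
by move=> [t z]/= [ht hz]; exact: ht.
Qed.

End uniform_to_joint.

Section clique_step.
Context (R : realType) (V : finType) (v : V) (N : nat) (C : 'I_N.+1 -> {set V}).
Context (K : forall i, R.-pker (vec R (sep v C i)) ~> (vec R (res v C i))).
Context (G : forall i, probability (vec R (res v C i)) R).
Context (a1 b1 : R -> vec R (res v C ord0)) (a b : R -> V -> R)
  (aS bS psi phi : forall i, vec R (sep v C i) -> vec R (res v C i)).
Hypothesis A1 : assumption_A1 K G a1 b1.
Hypothesis A2 : assumption_A2 K G a1 b1 a b aS bS psi phi.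
Hypothesis vC : v \in C ord0.
Local Notation full := (vec R [set: V]%SET).
Local Notation S := (sep v C).
Local Notation D := (res v C).

(* Total versions of the normings, with the convention a_v(t) = t, b_v(t) = 1;
   their values at negative times are irrelevant. *)
Definition anorm (t : R) (u : V) : R :=
  if u == v then t else if 0 <= t then a t u else 0.

Definition bnorm (t : R) (u : V) : R :=
  if u == v then 1 else if 0 <= t then b t u else 1.

Lemma bnorm_gt0 t u : 0 < bnorm t u.
Proof.
rewrite /bnorm; case: ifPn => // uv; case: ifPn => // t0.
exact: (A2_pos_b A2).
Qed.

Let measurable_patch (c : R) (f : R -> V -> R) u : u != v ->
  measurable_fun [set t : R | 0 <= t] (fun t : R => subvec [set~ v]%SET (f t)) ->
  measurable_fun setT (fun t : R => if 0 <= t then f t u else c).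
Proof.
move=> uv mf.
have uV : u \in [set~ v]%SET by rewrite !inE.
have mD : measurable [set t : R | 0 <= t].
  rewrite (_ : [set _ | _] = `[0, +oo[%classic) //.
  by apply/seteqP; split=> t /=; rewrite in_itv/= andbT.
apply: measurable_fun_if => //.
- exact: measurable_fun_ler.
- rewrite setTI (_ : _ @^-1` _ = [set t : R | 0 <= t])//.
  exact: (measurableT_comp (measurable_vec_proj (exist _ u uV)) mf).
Qed.

Lemma measurable_anorm u : measurable_fun setT (anorm ^~ u).
Proof.
have [uv|uv] := eqVneq u v.
  rewrite (_ : _ ^~ _ = id); first exact: measurable_id.
  by apply/funext => t; rewrite /anorm uv eqxx.
rewrite (_ : _ ^~ _ = (fun t : R => if 0 <= t then a t u else 0)).
  exact: measurable_patch (A2_measurable_a A2).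
by apply/funext => t; rewrite /anorm (negbTE uv).
Qed.

Lemma measurable_bnorm u : measurable_fun setT (bnorm ^~ u).
Proof.
have [uv|uv] := eqVneq u v.
  rewrite (_ : _ ^~ _ = cst 1); first exact: measurable_cst.
  by apply/funext => t; rewrite /bnorm uv eqxx.
rewrite (_ : _ ^~ _ = (fun t : R => if 0 <= t then b t u else 1)).
  exact: measurable_patch (A2_measurable_b A2).
by apply/funext => t; rewrite /bnorm (negbTE uv).
Qed.

(** As [v] lies in the first clique, a later clique that contains it has it in its separator. On
    residual vertices the total normings are therefore the assumed ones at nonnegative times. *)
Lemma v_notin_res i : v \notin D i.
Proof.
rewrite /res /sep inE negb_and negbK.
have [_|i0] := eqVneq i ord0; first by rewrite set11.
have [vi|_] := boolP (v \in C i); last by rewrite orbT.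
apply/orP; left; rewrite finset.in_setI vi /=.
by apply/bigcupP; exists ord0 => //; rewrite lt0n.
Qed.

Section later_clique.
Variable i : 'I_N.+1.
Hypothesis i0 : i != ord0.

Lemma destandardize_norm z t : 0 <= t ->
  destandardize anorm bnorm z t = destandardize a b z t :> vec R (S i).
Proof.
move=> t0; apply/funext => -[u uS]; rewrite /destandardize /anorm /bnorm /= t0.
have [uv|//] := eqVneq u v.
by rewrite uv in uS *; have [-> ->] := A2_v A2 i0 uS t0.
Qed.

(** Positivity of [bS] is assumed on the orthant only. Since [bnorm] is positive, destandardizing is
    increasing in the state, and growth at the lower corner [zl] covers the whole box. *)
Lemma orthant_near (zS : vec R (S i)) :
  \forall p \near filter_prod (pinfty_nbhs R) (nbhs zS),
    0 <= p.1 /\ orthant (S i) (destandardize anorm bnorm p.2 p.1).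
Proof.
have h u : \forall t \near +oo, 0 <= t /\ forall z, box zS 1 z ->
    0 <= destandardize anorm bnorm z t u.
  case: u => u uS.
  pose zl : vec R (S i) := fun u => zS u - 1.
  suff H : \forall t \near +oo,
      0 <= destandardize anorm bnorm zl t (exist _ u uS).
    near=> t; split; first by near: t; exact: nbhs_pinfty_ge.
    move=> z zb; apply: (@le_trans _ _ (destandardize anorm bnorm zl t (exist _ u uS))).
      by near: t.
    rewrite /destandardize lerD2l; apply: ler_wpM2l.
      exact: ltW (bnorm_gt0 _ _).
    by have := zb (exist _ u uS); rewrite ler_distl /zl => /andP[].
  rewrite /destandardize /= /anorm /bnorm.
  have [uv|uv] := eqVneq u v.
    near=> t; rewrite mul1r -lerBlDr sub0r; near: t.
    by apply: nbhs_pinfty_ge; exact: num_real.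
  have uV : u \in [set~ v]%SET by rewrite !inE.
  (* The growth condition takes a vector on all vertices but [v]; the entries outside [S i] are
     arbitrary and set to 0. *)
  pose z : vec R [set~ v]%SET := fun w => oapp zl 0 (insub (val w)).
  have /cvgryPge/(_ 0) := A2_growth A2 z (exist _ u uV).
  move=> hz; near=> t.
  have t0 : 0 <= t by near: t; exact: nbhs_pinfty_ge.
  rewrite t0; have : 0 <= destandardize a b z t (exist _ u uV) by near: t.
  by rewrite /destandardize /z /= insubT.
have H : \forall t \near +oo, 0 <= t /\ forall u z, box zS 1 z ->
    0 <= destandardize anorm bnorm z t u.
  have : \forall t \near +oo, forall u, 0 <= t /\ forall z, box zS 1 z ->
      0 <= destandardize anorm bnorm z t u by exact: filter_forall.
  move=> H; near=> t; split; first by near: t; exact: nbhs_pinfty_ge.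
  move=> u; have /(_ u)[] : forall u, 0 <= t /\ forall z, box zS 1 z ->
      0 <= destandardize anorm bnorm z t u by near: t.
  by [].
exists ([set t | 0 <= t /\ forall u z, box zS 1 z ->
    0 <= destandardize anorm bnorm z t u], box zS 1) => /=.
  by split=> //; exact: nbhs_box.
move=> [t z]/= [[t0 ht] zb]; split=> // u; exact: ht.
Unshelve. all: by end_near. Qed.

Section limits.
Variable zS : vec R (S i).
Let F := filter_prod (pinfty_nbhs R) (nbhs zS).
Let x (p : R * vec R (S i)) := destandardize anorm bnorm p.2 p.1.

Let F_prop : ProperFilter F.
Proof. exact: filter_prod_proper. Qed.

Let cvgF_snd : p.2 @[p --> F] --> zS.
Proof. exact: cvg_snd. Qed.

Let ra (t : R) (z : vec R (S i)) u :=
  (a t (val u) - aS (destandardize a b z t) u + b t (val u) * psi (i := i) z u)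
         / bS (destandardize a b z t) u.

Let rb (t : R) (z : vec R (S i)) (u : {u : V | u \in D i}) :=
  1 - b t (val u) * phi z u / bS (destandardize a b z t) u.

Let res_neq (u : {u : V | u \in D i}) : val u != v.
Proof.
by case: u => u uD /=; apply: contraTneq uD => ->; exact: v_notin_res.
Qed.

(* If phi vanished at zS, the second remainder would be constantly 1 there. *)
Lemma phi_gt0 u : 0 < phi zS u.
Proof.
rewrite lt_def (A2_ge0_phi A2)// andbT; apply/eqP => phi0.
have /(family_compact_joint zS) := A2_remainder_b A2 i0 u.
move=> /cvgrPdist_lt/(_ _ ltr01) [[U W]/= [FU nW] UW].
have [t Ut] := filter_ex FU.
have := UW (t, zS) (conj Ut (nbhs_singleton nW)).
by rewrite /= phi0 mulr0 mul0r subr0 sub0r normrN normr1 ltxx.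
Qed.

(** Solving the second remainder for the ratio gives bS/b = phi/(1 - rb), with rb tending to 0
    jointly and phi continuous; positivity of phi near [zS] justifies the division. *)
Lemma scale_cvg u : bS (x p) u / bnorm p.1 (val u) @[p --> F] --> phi zS u.
Proof.
have rb0 := family_compact_joint zS (A2_remainder_b A2 i0 u).
have phip : phi p.2 u @[p --> F] --> phi zS u.
  have cont := A2_continuous_phi A2 i0.
  have := @cvg_proj R V _ F _ (D i) (fun p => phi p.2) (phi zS) u.
  by apply; exact: (cvg_comp _ _ cvgF_snd (cont zS)).
have : phi p.2 u / (1 - rb p.1 p.2 u) @[p --> F] --> phi zS u / (1 - 0).
  apply: cvgM => //; apply: cvgV; first by rewrite subr0 oner_neq0.
  by apply: cvgB; [exact: cvg_cst|exact: rb0].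
rewrite subr0 divr1; apply: cvg_trans; apply: near_eq_cvg.
have /cvgr_gt/(_ 0 (phi_gt0 u)) phi_near := phip.
near=> p.
have [p0 xp] : 0 <= p.1 /\ orthant (S i) (x p).
  by near: p; exact: orthant_near.
have phip0 : 0 < phi p.2 u by near: p.
have bSp : 0 < bS (x p) u by exact: (A2_pos_bS A2).
have bp := bnorm_gt0 p.1 (val u).
rewrite /rb -(destandardize_norm _ p0) -/(x p) opprB addrC subrK.
have -> : b p.1 (val u) = bnorm p.1 (val u).
  by rewrite /bnorm (negbTE (res_neq u)) p0.
by field; rewrite !gt_eqF.
Unshelve. all: by end_near. Qed.

(** The first remainder gives (aS - a)/b = psi - ra (bS/b), where ra tends to 0 and the ratio bS/b
    converges by [scale_cvg]. *)
Lemma location_cvg u :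
  (aS (x p) u - anorm p.1 (val u)) / bnorm p.1 (val u) @[p --> F] --> psi zS u.
Proof.
have ra0 := family_compact_joint zS (A2_remainder_a A2 i0 u).
have psip : psi p.2 u @[p --> F] --> psi zS u.
  have cont := A2_continuous_psi A2 i0.
  have := @cvg_proj R V _ F _ (D i) (fun p => psi p.2) (psi zS) u.
  by apply; exact: (cvg_comp _ _ cvgF_snd (cont zS)).
have : psi p.2 u - ra p.1 p.2 u * (bS (x p) u / bnorm p.1 (val u)) @[p --> F]
    --> psi zS u - 0 * phi zS u.
  by apply: cvgB => //; apply: cvgM; [exact: ra0|exact: scale_cvg].
rewrite mul0r subr0; apply: cvg_trans; apply: near_eq_cvg; near=> p.
have [p0 xp] : 0 <= p.1 /\ orthant (S i) (x p).
  by near: p; exact: orthant_near.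
have bSp : 0 < bS (x p) u by exact: (A2_pos_bS A2).
have bp := bnorm_gt0 p.1 (val u).
rewrite /ra -(destandardize_norm _ p0) -/(x p).
have -> : b p.1 (val u) = bnorm p.1 (val u).
  by rewrite /bnorm (negbTE (res_neq u)) p0.
have -> : a p.1 (val u) = anorm p.1 (val u).
  by rewrite /anorm (negbTE (res_neq u)) p0.
by field; rewrite !gt_eqF.
Unshelve. all: by end_near. Qed.

Lemma kernel_cvg (f : vec R (D i) -> R) : bounded_continuous f ->
  \int[K i (x p)]_y f (standardize (aS (x p)) (bS (x p)) y) @[p --> F]
    --> \int[G i]_y f y.
Proof.
move=> f_bc; have [cf [M fM]] := f_bc.
have mf : measurable_fun setT f.
  by apply: discretizable_continuous_measurable => //; exact: discretizable_vec.
have := family_compact_joint zS (A2_cvg A2 i0 f_bc).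
apply: cvg_trans; apply: near_eq_cvg; near=> p.
have [p0 xp] : 0 <= p.1 /\ orthant (S i) (x p).
  by near: p; exact: orthant_near.
rewrite -(destandardize_norm _ p0) -/(x p) /Rintegral.
rewrite integral_pushforward//.
- exact: measurable_standardize.
- exact/measurable_EFinP.
- apply: (@integrable_bounded _ _ _ (K i (x p)) _ (fun y => _) M).
  + exact: prob_kernel.
  + by apply: measurableT_comp => //; exact: measurable_standardize.
  + by move=> y; exact: fM.
Unshelve. all: by end_near. Qed.

Lemma bS_neq0_near : \forall p \near F, forall u, bS (x p) u != 0.
Proof.
near=> p; have [p0 xp] : 0 <= p.1 /\ orthant (S i) (x p).
  by near: p; exact: orthant_near.
by move=> u; rewrite gt_eqF//; exact: (A2_pos_bS A2).
Unshelve. all: by end_near. Qed.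

End limits.

Lemma kstep_joint_cvg (h : R -> full -> R) (h0 : full -> R) (B : R) :
  (forall s, measurable_fun setT (h s)) -> (forall s z, 0 <= h s z <= B) ->
  joint_cvg h h0 ->
  joint_cvg (fun s => kstep (K i) anorm bnorm s (h s))
    (lstep (G i) (@psi i) (@phi i) h0).
Proof.
move=> mh hB hh0 z0.
have Fslice : (p.1, slice (S i) p.2) @[p --> filter_prod (pinfty_nbhs R) (nbhs z0)]
    --> filter_prod (pinfty_nbhs R) (nbhs (slice (S i) z0)).
  apply: (@cvg_pair _ _ _ (filter_prod (pinfty_nbhs R) (nbhs z0))
    (pinfty_nbhs R) (nbhs (slice (S i) z0))); first exact: cvg_fst.
  by apply: cvg_slice; exact: cvg_snd.
apply: (@cvg_kstep R V (S i) (D i) (K i) (G i) anorm bnorm (@aS i) (@bS i)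
  (@psi i) (@phi i) _ _ z0 h h0 B) => //.
- exact: cvg_fst.
- exact: cvg_snd.
- by move=> f f_bc; exact: (cvg_comp _ _ Fslice (kernel_cvg (slice (S i) z0) f_bc)).
- by move=> u; exact: (cvg_comp _ _ Fslice (@location_cvg _ u)).
- by move=> u; exact: (cvg_comp _ _ Fslice (@scale_cvg _ u)).
- exact: (Fslice _ (@bS_neq0_near _)).
Qed.

End later_clique.

Hypothesis psi0 : forall z u, psi (i := ord0) z u = 0.
Hypothesis phi0 : forall z u, phi (i := ord0) z u = 1.

Definition origin : full := fun=> 0.

Lemma sep_ord0 u : (u \in S ord0) = (u == v).
Proof. by rewrite /sep eqxx inE. Qed.

Lemma measurable_psi i : measurable_fun setT (@psi i).
Proof.
apply: measurable_vec => // u; have [i0|i0] := eqVneq i ord0.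
  subst i; rewrite (_ : (fun x => _) = cst 0); first exact: measurable_cst.
  exact/funext.
apply: discretizable_continuous_measurable; first exact: discretizable_vec.
have cont := A2_continuous_psi A2 i0; move=> z.
have := @cvg_proj R V _ (nbhs z) _ (D i) (@psi i) (psi z) u.
by apply; exact: cont.
Qed.

Lemma measurable_phi i : measurable_fun setT (@phi i).
Proof.
apply: measurable_vec => // u; have [i0|i0] := eqVneq i ord0.
  subst i; rewrite (_ : (fun x => _) = cst 1); first exact: measurable_cst.
  exact/funext.
apply: discretizable_continuous_measurable; first exact: discretizable_vec.
have cont := A2_continuous_phi A2 i0; move=> z.
have := @cvg_proj R V _ (nbhs z) _ (D i) (@phi i) (phi z) u.
by apply; exact: cont.
Qed.

(** The state before the first clique is always the origin, where the separator value is exactly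
    [s]; this is the conditioning in assumption A1, so convergence along this one path suffices.
    Kernel norming and target norming coincide there, in accordance with psi = 0 and phi = 1. *)
Lemma kstep_root_cvg (h : R -> full -> R) (h0 : full -> R) (B : R) :
  (forall s, measurable_fun setT (h s)) -> (forall s z, 0 <= h s z <= B) ->
  joint_cvg h h0 ->
  kstep (K ord0) anorm bnorm s (h s) origin @[s --> +oo]
    --> lstep (G ord0) (@psi ord0) (@phi ord0) h0 origin.
Proof.
move=> mh hB hh0.
have vS : v \in S ord0 by rewrite sep_ord0.
pose w : {u : V | u \in S ord0} := exist _ v vS.
have xE s : destandardize anorm bnorm (slice (S ord0) origin) s
    = (fun=> s) :> vec R (S ord0).
  apply/funext => -[u uS]; rewrite /destandardize /slice /subvec /= /origin.
  rewrite /entry mulr0 addr0 /anorm; move: (uS); rewrite sep_ord0 => /eqP ->.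
  by rewrite eqxx.
have res_neq (u : {u : V | u \in D ord0}) : val u != v.
  by case: u => u uD /=; apply: contraTneq uD => ->; exact: v_notin_res.
have aE s u : 0 <= s -> a1 s u = anorm s (val u).
  by move=> s0; rewrite -(A2_a1 A2)// /anorm (negbTE (res_neq u)) s0.
have bE s u : 0 <= s -> b1 s u = bnorm s (val u).
  by move=> s0; rewrite -(A2_b1 A2)// /bnorm (negbTE (res_neq u)) s0.
pose F : set_system (R * full) := (s, origin) @[s --> +oo].
have F_prop : ProperFilter F by exact: fmap_proper_filter.
have Fnear : F [set p | 0 <= p.1 /\ p.2 = origin].
  by apply: filterS (nbhs_pinfty_ge (num_real (0 : R))) => s s0.
have := @cvg_kstep R V (S ord0) (D ord0) (K ord0) (G ord0) anorm bnorm
  (fun x => a1 (x w)) (fun x => b1 (x w)) (@psi ord0) (@phi ord0) F F_prop origin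
  h h0 B mh hB hh0.
apply.
- by move=> U /= [M [Mr MU]]; exists M; split.
- by apply: cvg_cst.
- move=> f f_bc; have [cf [M fM]] := f_bc.
  have mf : measurable_fun setT f.
    by apply: discretizable_continuous_measurable => //; exact: discretizable_vec.
  pose q (p : R * full) :=
    let x := destandardize anorm bnorm (slice (S ord0) p.2) p.1 in
    \int[K ord0 x]_y f (standardize (a1 (x w)) (b1 (x w)) y).
  suff : q (s, origin) @[s --> +oo] --> \int[G ord0]_y f y by [].
  have := A1_cvg A1 f_bc; rewrite (_ : (fun s => q _) = (fun s =>
    fine (\int[pushforward (K ord0 (fun=> s)) (standardize (a1 s) (b1 s))]_y
      (f y)%:E))%E)//.
  apply/funext => s; rewrite /q /= xE /Rintegral [in RHS]integral_pushforward//.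
  + exact: measurable_standardize.
  + exact/measurable_EFinP.
  + apply: (@integrable_bounded _ _ _ (K ord0 (fun=> s)) _ (fun y => _) M).
    * exact: prob_kernel.
    * by apply: measurableT_comp => //; exact: measurable_standardize.
    * by move=> y; exact: fM.
- move=> u; rewrite psi0; apply: cvg_near_cst; near=> p.
  have [p0 p2] : 0 <= p.1 /\ p.2 = origin by near: p; exact: Fnear.
  by rewrite /= p2 xE aE// subrr mul0r.
- move=> u; rewrite phi0; apply: cvg_near_cst; near=> p.
  have [p0 p2] : 0 <= p.1 /\ p.2 = origin by near: p; exact: Fnear.
  by rewrite /= p2 xE bE// divff// gt_eqF// bnorm_gt0.
- near=> p => u.
  have [p0 p2] : 0 <= p.1 /\ p.2 = origin by near: p; exact: Fnear.
  by rewrite /= p2 xE bE// gt_eqF// bnorm_gt0.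
Unshelve. all: by end_near. Qed.

(** * Iteration of the operators over the cliques *)

Local Notation idx n := (inord n : 'I_N.+1).

(** The recursion runs backwards: the last clique acts first on [h], the root last. The index
    [inord m] is faithful only for [m <= N]. *)
Fixpoint kiter (n : nat) (s : R) (h : full -> R) : R :=
  if n is m.+1 then kiter m s (kstep (K (idx m)) anorm bnorm s h) else h origin.

Fixpoint liter (n : nat) (h : full -> R) : R :=
  if n is m.+1 then liter m (lstep (G (idx m)) (@psi (idx m)) (@phi (idx m)) h)
  else h origin.

Lemma measurable_kstep_at i s (h : full -> R) (B : R) :
  measurable_fun setT h -> (forall z, 0 <= h z <= B) ->
  measurable_fun setT (kstep (K i) anorm bnorm s h).
Proof.
move=> mh hB.
have := @measurable_kstep R V (S i) (D i) (K i) anorm bnorm (fun p => h p.2) B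
  measurable_anorm measurable_bnorm bnorm_gt0.
move=> H; apply: (measurableT_comp (H _ _) (pair1_measurable s)) => //.
exact: measurableT_comp.
Qed.

(** The induction starts at one operator, not at none: the root is treated along the origin only,
    while every later operator preserves [joint_cvg]. *)
Lemma kiter_cvg n (h : R -> full -> R) (h0 : full -> R) (B : R) : (n <= N)%N ->
  (forall s, measurable_fun setT (h s)) -> (forall s z, 0 <= h s z <= B) ->
  joint_cvg h h0 ->
  kiter n.+1 s (h s) @[s --> +oo] --> liter n.+1 h0.
Proof.
elim: n h h0 => [|n IH] h h0 nN mh hB hh0.
  rewrite /kiter /liter (_ : inord 0 = ord0); first exact: kstep_root_cvg hB hh0.
  by apply: val_inj; rewrite /= inordK.
apply: (IH (fun s => kstep (K (idx n.+1)) anorm bnorm s (h s))).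
- exact: ltnW.
- by move=> s; exact: measurable_kstep_at.
- by move=> s z; exact: kstep_bounds.
- apply: kstep_joint_cvg hB hh0 => //.
  by apply/eqP => /(congr1 val); rewrite /= inordK.
Qed.

Lemma kiter_bounds n s (h : full -> R) (B : R) : measurable_fun setT h ->
  (forall z, 0 <= h z <= B) -> 0 <= kiter n s h <= B.
Proof.
elim: n h => [|n IH] h mh hB //=; apply: IH; last exact: kstep_bounds.
exact: measurable_kstep_at hB.
Qed.

Lemma measurable_kiter n (f : R * full -> R) (B : R) :
  measurable_fun setT f -> (forall p, 0 <= f p <= B) ->
  measurable_fun setT (fun s => kiter n s (fun z => f (s, z))).
Proof.
elim: n f => [|n IH] f mf fB /=.
  by apply: measurableT_comp => //; exact: pair2_measurable.
pose g p := kstep (K (idx n)) anorm bnorm p.1 (fun z => f (p.1, z)) p.2.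
apply: (IH g).
  exact: (@measurable_kstep R V _ _ (K (idx n)) anorm bnorm f B
    measurable_anorm measurable_bnorm bnorm_gt0 mf fB).
move=> p; apply: kstep_bounds => //.
by apply: measurableT_comp => //; exact: pair1_measurable.
Qed.

Lemma measurable_lstep i (h : full -> R) (B : R) :
  measurable_fun setT h -> (forall z, 0 <= h z <= B) ->
  measurable_fun setT (lstep (G i) (@psi i) (@phi i) h).
Proof.
move=> mh hB; apply: (measurableT_comp (fine_measurable _)) => //.
apply: (measurable_fun_fubini_tonelli_F (m2 := G i) (fun p : full * vec R (D i) =>
   (h (upd p.1 (fun u => psi (slice (S i) p.1) u + phi (slice (S i) p.1) u * p.2 u)))%:E)).
  apply/measurable_EFinP; apply: measurableT_comp => //.
  apply: measurable_upd => //; apply: measurable_vec => // u.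
  have mS : measurable_fun setT (fun p : full * vec R (D i) => slice (S i) p.1).
    by apply: measurableT_comp => //; exact: measurable_slice.
  apply: measurable_funD; last apply: measurable_funM.
  - exact: (measurableT_comp (measurable_vec_proj u)
      (measurableT_comp (@measurable_psi i) mS)).
  - exact: (measurableT_comp (measurable_vec_proj u)
      (measurableT_comp (@measurable_phi i) mS)).
  - exact: (measurableT_comp (measurable_vec_proj u)).
by move=> p; rewrite lee_fin; have /andP[] := hB (upd p.1 (fun u =>
  psi (slice (S i) p.1) u + phi (slice (S i) p.1) u * p.2 u)).
Qed.

(** * The law of the normed vector *)

Context dO (Omega : measurableType dO) (P : probability Omega R).
Context (X : V -> {RV P >-> R}) (e : rel V).
Hypothesis Cord : clique_ordering e v C.
Hypothesis GM : graphical_model e X K.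

(** Adding [v] makes [seen 0] the root separator, so that the root obeys the same recursion as the
    other cliques. *)
Definition seen (n : nat) : {set V} :=
  (v |: \bigcup_(j < N.+1 | (j < n)%N) C j)%SET.

Lemma v_seen n : v \in seen n.
Proof. by rewrite /seen setU11. Qed.

Lemma seen0 : seen 0 = [set v]%SET.
Proof. by rewrite /seen big_pred0 ?finset.setU0// => j; rewrite ltn0. Qed.

Lemma seen_prev (i : 'I_N.+1) : i != ord0 -> seen i = prev_cliques C i.
Proof.
move=> i0; apply/finset.setUidPr; rewrite finset.sub1set; apply/bigcupP.
by exists ord0 => //; rewrite lt0n.
Qed.

Lemma sep_seen i : S i \subset seen i.
Proof.
rewrite /sep; case: ifPn => [_|i0]; first by rewrite finset.sub1set v_seen.
by rewrite seen_prev// subsetIr.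
Qed.

Lemma res_notin_seen i u : u \in D i -> u \notin seen i.
Proof.
move=> uD; have uv : u != v.
  by apply: contraTneq uD => ->; exact: v_notin_res.
move: uD; rewrite /res /sep !inE (negbTE uv)/=; case: ifPn => [/eqP ->|i0].
  by rewrite big_pred0 ?inE// => j; rewrite ltn0.
by rewrite finset.in_setI => /andP[+ uC]; rewrite uC.
Qed.

Lemma seenS (i : 'I_N.+1) : seen i.+1 = (seen i :|: D i)%SET.
Proof.
apply/setP => u; apply/idP/idP.
  rewrite !inE => /orP[->//|/bigcupP[j ji uj]].
  have [ij|] := eqVneq j i.
    rewrite -ij uj andbT orbC; have [uS|//] := boolP (u \in S j) => /=.
    by have := fintype.subsetP (sep_seen j) u uS; rewrite !inE.
  move=> ji'; apply/orP; left; apply/orP; right; apply/bigcupP; exists j => //.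
  by rewrite ltn_neqAle ji' -ltnS.
rewrite finset.in_setU => /orP[|]; rewrite !inE.
  move=> /orP[->//|/bigcupP[j ji uj]]; apply/orP; right; apply/bigcupP.
  by exists j => //; exact: ltnW.
by move=> /andP[_ uC]; apply/orP; right; apply/bigcupP; exists i.
Qed.

(** A singleton is a clique, hence contained in a maximal one, which is some [C j]. *)
Lemma seen_full : seen N.+1 = [set: V]%SET.
Proof.
apply/setP => u; rewrite !inE; apply/orP; right.
have u_clique : clique e [set u]%SET.
  apply/forall_inP => x /set1P ->; apply/forall_inP => y /set1P ->.
  by rewrite eqxx.
have [B /(clique_max Cord)[j <-] uB] := maxset_exists u_clique.
by apply/bigcupP; exists j => //; apply: (fintype.subsetP uB); rewrite inE.
Qed.

(** The norming is by [x v] itself, so the [v]-entry is (x_v - x_v)/1 = 0 and the state on [seen 0]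
    is the origin. *)
Definition std_state (A : {set V}) (x : V -> R) : full := subvec [set: V]%SET
  (fun u => if u \in A
    then (x u - anorm (x v) u) / bnorm (x v) u else 0).

Definition ext (A : {set V}) (y : vec R A) (u : V) : R :=
  oapp y 0 (insub u).

Lemma ext_subrv (A : {set V}) w u : u \in A -> ext (subrv A X w) u = X u w.
Proof. by move=> uA; rewrite /ext insubT. Qed.

Lemma measurable_ext (A : {set V}) u :
  measurable_fun setT (fun y : vec R A => ext y u).
Proof.
rewrite /ext; case: insubP => [u' _ _|_] /=; last exact: measurable_cst.
exact: measurable_vec_proj.
Qed.

Lemma measurable_subrv (A : {set V}) : measurable_fun setT (subrv A X).
Proof. by apply: measurable_subvec => u _; exact: measurable_funP. Qed.

Lemma measurable_standardized d (T : measurableType d) (f g : T -> R) u :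
  measurable_fun setT f -> measurable_fun setT g ->
  measurable_fun setT (fun t => (f t - anorm (g t) u) / bnorm (g t) u).
Proof.
move=> mf mg; apply: measurable_funM.
  by apply: measurable_funB => //; exact: (measurableT_comp (measurable_anorm u)).
apply: measurable_fun_invr; last by move=> t; exact: bnorm_gt0.
exact: (measurableT_comp (measurable_bnorm u)).
Qed.

Lemma measurable_std_state d (T : measurableType d) A (x : T -> V -> R) :
  (forall u, measurable_fun setT (x ^~ u)) ->
  measurable_fun setT (fun t => std_state A (x t)).
Proof.
move=> mx; apply: measurable_subvec => u _ /=.
case: (u \in A); last first.
  exact: measurable_cst.
by apply: measurable_standardized; exact: mx.
Qed.

(** [A] is kept apart from [seen i] because the type of the conditioning vector depends on it: the
    model provides [sep] for the root and [prev_cliques] afterwards. *)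
Lemma cond_kernel_step (i : 'I_N.+1) (A : {set V}) (f : R * full -> R) (B : R) :
  A = seen i ->
  (forall B, measurable B ->
    is_cond_prob P (subrv A X) (subrv (D i) X @^-1` B)
      (fun w => K i (subrv (S i) X w) B)) ->
  measurable_fun setT f -> (forall p, 0 <= f p <= B) ->
  \int[P]_w f (X v w, std_state (seen i.+1) (X ^~ w)) =
  \int[P]_w kstep (K i) anorm bnorm (X v w) (fun z => f (X v w, z))
    (std_state (seen i) (X ^~ w)).
Proof.
move=> As condK mf fB.
pose x (y : vec R A) : vec R (S i) := subvec (S i) (ext y).
have mx : measurable_fun setT x.
  by apply: measurable_subvec => u _; exact: measurable_ext.
have vA : v \in A by rewrite As v_seen.
have xW w : x (subrv A X w) = subrv (S i) X w.
  apply/funext => -[u uS]; rewrite /x /subvec /= ext_subrv//.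
  by rewrite As; exact: (fintype.subsetP (sep_seen i)).
pose F (p : vec R A * vec R (D i)) : R :=
  f (ext p.1 v, upd (std_state A (ext p.1))
      (standardize (subvec (D i) (anorm (ext p.1 v)))
                   (subvec (D i) (bnorm (ext p.1 v))) p.2)).
have mF : measurable_fun setT F.
  apply: measurableT_comp => //.
  have mext u : measurable_fun setT (fun p : vec R A * vec R (D i) => ext p.1 u).
    exact: (measurableT_comp (measurable_ext u)).
  apply: measurable_fun_pair => //; apply: measurable_upd.
    exact: measurable_std_state.
  apply: measurable_vec => // u; apply: measurable_standardized => //.
  exact: (measurableT_comp (measurable_vec_proj u)).
have stdE w : std_state A (ext (subrv A X w)) = std_state (seen i) (X ^~ w).
  rewrite /std_state As; congr subvec; apply/funext => u; case: ifPn => // uA.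
  by rewrite !ext_subrv// -As.
have FE w : f (X v w, std_state (seen i.+1) (X ^~ w))
    = F (subrv A X w, subrv (D i) X w).
  rewrite /F /= stdE ext_subrv//; congr (f (_, _)); apply: state_eq => u.
  have [uD|uD] := boolP (u \in D i).
    rewrite (entry_upd_in _ _ (exist _ u uD)) /std_state entry_subvec seenS.
    by rewrite finset.in_setU uD orbT.
  rewrite entry_upd_out// /std_state !entry_subvec seenS finset.in_setU.
  by rewrite (negbTE uD) orbF.
have condK' B' : measurable B' -> is_cond_prob P (subrv A X)
    (subrv (D i) X @^-1` B') (fun w => K i (x (subrv A X w)) B').
  by move=> /condK; under [X in _ -> is_cond_prob _ _ _ X]eq_fun do rewrite xW.
have mEF : measurable_fun setT (EFin \o F) by exact/measurable_EFinP.
have := @integral_cond_law R _ Omega P _ _ _ _ _ _ (K i) x mx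
  (subrv A X) (subrv (D i) X) (@measurable_subrv A) (@measurable_subrv (D i))
  condK' (EFin \o F) mEF _.
move=> H; rewrite /Rintegral; congr fine.
under eq_integral do rewrite FE.
rewrite [LHS]H; last first.
  by move=> p; rewrite lee_fin /F; have /andP[] := fB (ext p.1 v,
    upd (std_state A (ext p.1)) (standardize (subvec (D i) (anorm (ext p.1 v)))
                   (subvec (D i) (bnorm (ext p.1 v))) p.2)).
apply: eq_integral => w _.
rewrite /kstep xW.
(* Destandardizing undoes the standardization, so [kstep] evaluates the kernel at the actual
   separator values. *)
have -> : destandardize anorm bnorm (slice (S i) (std_state (seen i) (X ^~ w)))
    (X v w) = subrv (S i) X w.
  apply/funext => -[u uS]; rewrite /destandardize /slice /subrv /subvec /=.
  rewrite /std_state entry_subvec (fintype.subsetP (sep_seen i))//.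
  have := lt0r_neq0 (bnorm_gt0 (X v w) u).
  move: (bnorm _ _) (anorm _ _) (X u w) => c c' r c0.
  by field.
rewrite (@EFin_Rintegral _ _ _ (K i (subrv (S i) X w)) _ _ 0 B).
- apply: eq_integral => y _; rewrite /F /= stdE ext_subrv//.
- exact: prob_kernel.
- apply: (measurableT_comp mf); apply: (measurableT_comp (pair1_measurable (X v w))).
  by apply: measurable_upd => //; exact: measurable_standardize.
- by move=> y; exact: fB.
Qed.

Lemma kernel_step (i : 'I_N.+1) (f : R * full -> R) (B : R) :
  measurable_fun setT f -> (forall p, 0 <= f p <= B) ->
  \int[P]_w f (X v w, std_state (seen i.+1) (X ^~ w)) =
  \int[P]_w kstep (K i) anorm bnorm (X v w) (fun z => f (X v w, z))
    (std_state (seen i) (X ^~ w)).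
Proof.
have [->|i0] := eqVneq i ord0.
  apply: (@cond_kernel_step _ (S ord0)); last exact: (kernel_sep GM).
  by rewrite seen0 /sep eqxx.
apply: (@cond_kernel_step _ (prev_cliques C i)); first by rewrite seen_prev.
exact: (kernel_prev GM).
Qed.

Lemma integral_kiter n (f : R * full -> R) (B : R) : (n <= N.+1)%N ->
  measurable_fun setT f -> (forall p, 0 <= f p <= B) ->
  \int[P]_w f (X v w, std_state (seen n) (X ^~ w)) =
  \int[P]_w kiter n (X v w) (fun z => f (X v w, z)).
Proof.
elim: n f => [|n IH] f nN mf fB.
  apply: eq_Rintegral => w _ /=; congr (f (_, _)); apply: state_eq => u.
  rewrite /std_state entry_subvec seen0 inE; case: eqP => // ->.
  by rewrite /anorm eqxx subrr mul0r.
pose g p := kstep (K (idx n)) anorm bnorm p.1 (fun z => f (p.1, z)) p.2.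
have in_n : (idx n : nat) = n by rewrite inordK.
rewrite -{1}in_n (kernel_step _ mf fB) /= -(IH g) ?in_n//; first exact: ltnW.
- exact: (@measurable_kstep R V _ _ (K (idx n)) anorm bnorm f B
    measurable_anorm measurable_bnorm bnorm_gt0 mf fB).
- move=> p; apply: kstep_bounds => //.
  by apply: measurableT_comp => //; exact: pair1_measurable.
Qed.

(** * The limit *)

Lemma seen_subset n m : (n <= m)%N -> seen n \subset seen m.
Proof.
move=> nm; apply: finset.setUS; apply/bigcupsP => j jn.
by apply: finset.bigcup_sup; exact: leq_trans nm.
Qed.

Lemma res_sub_seen (i : 'I_N.+1) : D i \subset seen i.+1.
Proof. by rewrite seenS finset.subsetUr. Qed.

Lemma entry_upd_seen (i : 'I_N.+1) (y : vec R (D i)) (z : full) u :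
  u \in seen i -> entry (upd z y) u = entry z u.
Proof.
move=> us; apply: entry_upd_out; apply: contraL us; exact: res_notin_seen.
Qed.

Lemma slice_upd_in (A : {set V}) (z : full) (y : vec R A) : slice A (upd z y) = y.
Proof. by apply/funext => u; rewrite /slice /subvec entry_upd_in. Qed.

Definition lupd (i : 'I_N.+1) (z : full) (y : vec R (D i)) : full :=
  upd z (fun u => psi (slice (S i) z) u + phi (slice (S i) z) u * y u).

(* The limit as a function of the noise, the noise vectors being the
   restrictions of a single element of R^V to the sets C_i \ S_i. *)
Fixpoint zrec (n : nat) (xi : full) : full :=
  if n is m.+1 then lupd (zrec m xi) (slice (D (idx m)) xi) else origin.

Lemma measurable_lupd i : measurable_fun setT (fun p => @lupd i p.1 p.2).
Proof.
apply: measurable_upd => //; apply: measurable_vec => // u.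
have mS : measurable_fun setT (fun p : full * vec R (D i) => slice (S i) p.1).
  by apply: measurableT_comp => //; exact: measurable_slice.
apply: measurable_funD; last apply: measurable_funM.
- exact: (measurableT_comp (measurable_vec_proj u)
    (measurableT_comp (@measurable_psi i) mS)).
- exact: (measurableT_comp (measurable_vec_proj u)
    (measurableT_comp (@measurable_phi i) mS)).
- exact: (measurableT_comp (measurable_vec_proj u)).
Qed.

Lemma measurable_zrec n : measurable_fun setT (zrec n).
Proof.
elim: n => [|n IH] /=; first exact: measurable_cst.
have mp : measurable_fun setT (fun xi => (zrec n xi, slice (D (idx n)) xi)).
  by apply: measurable_fun_pair => //; exact: measurable_slice.
exact: (measurableT_comp (@measurable_lupd (idx n)) mp).
Qed.

Lemma zrec_stable n m xi u : (n <= m)%N -> (m <= N.+1)%N -> u \in seen n ->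
  entry (zrec m xi) u = entry (zrec n xi) u.
Proof.
move=> nm mN us; elim: m nm mN => [|m IH]; first by rewrite leqn0 => /eqP ->.
rewrite leq_eqVlt => /orP[/eqP <- //|nm mN].
rewrite -(IH nm (ltnW mN)) /=; apply: entry_upd_seen; rewrite inordK//.
exact: (fintype.subsetP (seen_subset (nm : (n <= m)%N))).
Qed.

Lemma slice_upd_out (i j : 'I_N.+1) (y : vec R (D j)) xi : (i < j)%N ->
  slice (D i) (upd xi y) = slice (D i) xi.
Proof.
move=> ij; apply/funext => -[u uD]; apply: entry_upd_seen.
apply: (fintype.subsetP (seen_subset ij)).
exact: (fintype.subsetP (res_sub_seen i)).
Qed.

(** The first [n] steps read the noise only on residuals of cliques before [n], which are disjoint
    from [D i]. *)
Lemma zrec_upd n (i : 'I_N.+1) (y : vec R (D i)) xi : (n <= i)%N ->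
  zrec n (upd xi y) = zrec n xi.
Proof.
elim: n => [//|n IH] ni /=; rewrite (IH (ltnW ni)) slice_upd_out//.
by rewrite inordK// (ltn_trans ni).
Qed.

(** The equation holds when step i is performed and survives to the end: separator entries are
    frozen before that step, residual entries after it. *)
Lemma zrec_eq (i : 'I_N.+1) xi (u : {u : V | u \in D i}) :
  entry (zrec N.+1 xi) (val u) =
    psi (slice (S i) (zrec N.+1 xi)) u
      + phi (slice (S i) (zrec N.+1 xi)) u * slice (D i) xi u.
Proof.
have iN : (i < N.+1)%N by [].
have -> : slice (S i) (zrec N.+1 xi) = slice (S i) (zrec i xi).
  apply/funext => -[w wS]; apply: zrec_stable => //; first exact: ltnW.
  exact: (fintype.subsetP (sep_seen i)).
rewrite (@zrec_stable i.+1 N.+1)//; last first.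
  by apply: (fintype.subsetP (res_sub_seen i)); exact: valP.
by rewrite /= inord_val /lupd entry_upd_in.
Qed.

Lemma zrec_root xi : entry (zrec N.+1 xi) v = 0.
Proof. by rewrite (@zrec_stable 0 N.+1)// v_seen. Qed.

Definition upd_mfun (A : {set V}) : {mfun (full * vec R A)%type >-> full} :=
  mfun_Sub (mem_set (measurable_upd measurable_fst measurable_snd)).

(** Each stage draws a fresh vector from [G] and writes it on the residual of that clique; the
    disjoint residuals encode the independent family inside R^V, without a dependent product of
    spaces. *)
Fixpoint noise (n : nat) : probability full R :=
  if n is m.+1
  then distribution (noise m \x G (idx m))%E (upd_mfun (D (idx m)))
  else \d_origin.

Lemma ge0_integral_noiseS n (f : full -> \bar R) :
  measurable_fun setT f -> (forall z, 0 <= f z)%E ->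
  (\int[noise n.+1]_z f z =
    \int[noise n]_z \int[G (idx n)]_y f (upd z y))%E.
Proof.
move=> mf f0; rewrite /= ge0_integral_distribution//.
rewrite fubini_tonelli1//=.
exact: (measurableT_comp mf (measurable_upd measurable_fst measurable_snd)).
Qed.

(** By Tonelli the last draw is integrated first, and by [zrec_upd] the earlier state does not
    depend on it; that inner integral is [lstep]. *)
Lemma integral_zrec n (h : full -> R) (B : R) : (n <= N.+1)%N ->
  measurable_fun setT h -> (forall z, 0 <= h z <= B) ->
  \int[noise n]_xi h (zrec n xi) = liter n h.
Proof.
elim: n h => [|n IH] h nN mh hB.
  by rewrite /= Rintegral_prob_cst//; exact: probability_setT.
have in_n : (idx n : nat) = n by rewrite inordK.
rewrite [RHS]/= -(IH _ (ltnW nN)); last 2 first.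
- exact: measurable_lstep hB.
- by move=> z; exact: lstep_bounds.
rewrite /Rintegral; congr fine; rewrite ge0_integral_noiseS; last 2 first.
- by apply/measurable_EFinP; apply: measurableT_comp => //; exact: measurable_zrec.
- by move=> z; rewrite lee_fin; have /andP[] := hB (zrec n.+1 z).
apply: eq_integral => xi _.
rewrite /lstep (@EFin_Rintegral _ _ _ (G (idx n)) _ _ 0 B).
- apply: eq_integral => y _; rewrite [zrec n.+1 _]/=.
  by rewrite zrec_upd ?in_n// slice_upd_in.
- exact: probability_setT.
- apply: measurableT_comp => //.
  exact: (measurableT_comp (@measurable_lupd _) (pair1_measurable _)).
- by move=> y; exact: hB.
Qed.

(** Restricting the constraints to [i < n] makes the induction work: pulled back along [upd], the
    event becomes a rectangle, with second side [setT] when the new clique is not in [J]. *)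
Lemma noise_indep n (J : {set 'I_N.+1}) (B : forall i, set (vec R (D i))) :
  (n <= N.+1)%N -> (forall i, measurable (B i)) ->
  noise n [set xi | forall i, i \in J -> (i < n)%N -> B i (slice (D i) xi)]
    = (\prod_(i in J | (i < n)%N) G i (B i))%E.
Proof.
move=> nN mB; elim: n nN => [|n IH] nN.
  rewrite big_pred0; last by move=> i; rewrite ltn0 andbF.
  by rewrite (_ : [set _ | _] = setT) ?probability_setT//; apply/seteqP; split.
have in_n : (idx n : nat) = n by rewrite inordK.
pose J' := [set xi | forall i, i \in J -> (i < n)%N -> B i (slice (D i) xi)].
pose Bn := if idx n \in J then B (idx n) else setT.
have mBn : measurable Bn by rewrite /Bn; case: ifP.
have mJ' : measurable J'.
  rewrite (_ : J' = \bigcap_(i in [set i | (i \in J) && (i < n)%N])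
      (slice (D i) @^-1` B i)).
    apply: fin_bigcap_measurable => //.
    move=> i _; rewrite -[_ @^-1` _]setTI.
    exact: (@measurable_slice R V (D i) measurableT (B i) (mB i)).
  apply/seteqP; split=> xi /=; first by move=> h i /= /andP[]; exact: h.
  by move=> h i iJ ni; apply: h; rewrite /= iJ.
rewrite /= /distribution /pushforward.
rewrite (_ : _ @^-1` _ = J' `*` Bn).
  rewrite product_measure1E// [X in (X * _)%E](IH (ltnW nN)).
  rewrite [RHS](bigID (pred1 (idx n)))/= muleC; congr (_ * _)%E.
    rewrite /Bn; case: ifP => nJ.
      rewrite (big_pred1 (idx n))// => i /=.
      by have [->|] := eqVneq i (idx n); rewrite ?nJ ?in_n ?ltnSn ?andbF.
    rewrite probability_setT big_pred0// => i /=.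
    by have [->|] := eqVneq i (idx n); rewrite ?nJ ?andbF.
  apply: eq_bigl => i; rewrite -andbA; congr (_ && _).
  by rewrite -val_eqE /= in_n ltnS ltn_neqAle andbC.
apply/seteqP; split=> -[xi y]/=.
  move=> h; split.
    move=> i iJ ni; rewrite -(slice_upd_out (j := idx n) y) ?in_n//.
    by apply: h => //; exact: ltnW.
  rewrite /Bn; case: ifP => // nJ.
  by rewrite -(slice_upd_in xi y); apply: h; rewrite ?in_n.
move=> [h yB] i iJ; rewrite ltnS leq_eqVlt => /orP[/eqP ni|ni].
  have iE : i = idx n by apply: val_inj; rewrite /= in_n.
  by subst i; rewrite slice_upd_in; move: yB; rewrite /Bn iJ.
by rewrite slice_upd_out ?in_n//; exact: h.
Qed.

Lemma noise_marginal i (B : set (vec R (D i))) : measurable B ->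
  noise N.+1 (slice (D i) @^-1` B) = G i B.
Proof.
move=> mB.
(* A dependent family equal to [B] at [i] and unconstrained elsewhere. *)
pose F j : set (vec R (D j)) := dfwith (fun j => setT) i B j.
have mF j : measurable (F j) by rewrite /F; case: dfwithP.
have FB : F i = B by exact: dfwithin.
have := @noise_indep N.+1 [set i]%SET F (leqnn _) mF.
rewrite (big_pred1 i) => [|j /=]; last by rewrite inE ltn_ord andbT.
rewrite FB => <-; congr (noise _ _); apply/seteqP; split=> xi /=.
  by move=> xiB j; rewrite inE => /eqP -> _; rewrite FB.
by move/(_ i); rewrite FB; apply=> //; rewrite inE.
Qed.

Lemma noise_mutually_independent (J : {set 'I_N.+1})
    (B : forall i, set (vec R (D i))) : (forall i, measurable (B i)) ->
  noise N.+1 (\bigcap_(i in [set` J]) (slice (D i) @^-1` B i))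
    = (\prod_(i in J) noise N.+1 (slice (D i) @^-1` B i))%E.
Proof.
move=> mB.
rewrite (_ : \bigcap_(i in _) _ =
  [set xi | forall i, i \in J -> (i < N.+1)%N -> B i (slice (D i) xi)]).
  rewrite noise_indep//; apply: eq_big => i; first by rewrite ltn_ord andbT.
  by move=> _; rewrite noise_marginal.
apply/seteqP; split=> xi /=; first by move=> h i iJ _; exact: h.
by move=> h i iJ; exact: h.
Qed.

(** * Limit of the conditional laws *)

Section limit.
Hypothesis expX : unit_exponential (X v).
Variable f : R * full -> R.
Variable B : R.
Hypothesis mf : measurable_fun setT f.
Hypothesis fB : forall p, 0 <= f p <= B.
Hypothesis cf : forall y, continuous (fun z => f (y, z)).

Let Yt (t : R) (w : Omega) : R * full :=
  (X v w - t, std_state (seen N.+1) (X ^~ w)).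

Let measurable_Yt t : measurable_fun setT (Yt t).
Proof.
apply: measurable_fun_pair; first exact: measurable_funB.
by apply: measurable_std_state => u; exact: measurable_funP.
Qed.

(** Here [y] is the overshoot X_v - t: the kernels act at the level y + t, while [f] sees only
    [y]. *)
Let g (t y : R) : R := kiter N.+1 (y + t) (fun z => f (y, z)).

Let mfy y : measurable_fun setT (fun z => f (y, z)).
Proof. by apply: measurableT_comp => //; exact: pair1_measurable. Qed.

Let g_bounds t y : 0 <= g t y <= B.
Proof. exact: kiter_bounds. Qed.

Let B0 : 0 <= B.
Proof. by have /andP[] := fB (0, origin); exact: le_trans. Qed.

Let measurable_g t : measurable_fun setT (g t).
Proof.
have := @measurable_kiter N.+1 (fun p : R * full => f (p.1 - t, p.2)) B.
move=> H; have {}H := H _ (fun p => fB (p.1 - t, p.2)).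
have mt : measurable_fun setT (fun p : R * full => f (p.1 - t, p.2)).
  apply: (measurableT_comp mf); apply: measurable_fun_pair => //.
  exact: measurable_funB.
have mD : measurable_fun setT (fun y : R => y + t) by exact: measurable_funD.
rewrite (_ : g t = (fun s => kiter N.+1 s (fun z => f (s - t, z))) \o (+%R^~ t)).
  exact: (measurableT_comp (H mt) mD).
by apply/funext => y; rewrite /g /= addrK.
Qed.

Lemma Rintegral_law_given t : 0 <= t ->
  fine (\int[law_given P [set w | (t < X v w)%R] (Yt t)]_p (f p)%:E)%E
    = \int[P]_w g t (X v w).
Proof.
move=> t0.
have mD := @measurable_gt _ _ _ P (X v) t.
have PD : P [set w | t < X v w] = (expR (- t))%:E.
  by rewrite exponential_tail// min_l// -expR0 ler_expR oppr_le0.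
rewrite (ge0_integral_law_given P mD (@measurable_Yt t)); last 2 first.
- exact/measurable_EFinP.
- by move=> p; rewrite lee_fin; have /andP[] := fB p.
(* Extending the integrand by 0 below the threshold makes it a function on the whole space, to which
   [integral_kiter] applies. *)
pose ft (p : R * full) : R := if t < p.1 then f (p.1 - t, p.2) else 0.
have mft : measurable_fun setT ft.
  apply: measurable_fun_ifT => //; first exact: measurable_fun_ltr.
  apply: measurableT_comp => //; apply: measurable_fun_pair => //.
  exact: measurable_funB.
have ftB p : 0 <= ft p <= B by rewrite /ft; case: ifP => // _; rewrite lexx.
have kftB : forall w, 0 <= kiter N.+1 (X v w) (fun z => ft (X v w, z)) <= B.
  move=> w; apply: kiter_bounds => //.
  by apply: measurableT_comp => //; exact: pair1_measurable.
have mkft : measurable_fun setT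
    (fun w => kiter N.+1 (X v w) (fun z => ft (X v w, z))).
  apply: (measurableT_comp (measurable_kiter N.+1 mft ftB)).
  exact: measurable_funP.
have mXs : measurable_fun setT (fun w => (X v w, std_state (seen N.+1) (X ^~ w))).
  apply: measurable_fun_pair; first exact: measurable_funP.
  by apply: measurable_std_state => u; exact: measurable_funP.
have -> : (\int[P]_(w in [set w | (t < X v w)%R]) (f (Yt t w))%:E
    = \int[P]_w (ft (X v w, std_state (seen N.+1) (X ^~ w)))%:E)%E.
  rewrite integral_mkcond; apply: eq_integral => w _.
  rewrite /ft /= patchE; case: ifPn; first by rewrite inE /= => ->.
  by rewrite notin_setE /= => /negP/negbTE ->.
rewrite -(EFin_Rintegral (probability_setT P) (a := 0) (b := B)); last 2 first.
- exact: measurableT_comp.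
- by move=> w; exact: ftB.
rewrite (integral_kiter (leqnn _) mft ftB).
rewrite (EFin_Rintegral (probability_setT P) mkft kftB).
have -> : (\int[P]_w (kiter N.+1 (X v w) (fun z => ft (X v w, z)))%:E
    = \int[P]_(w in [set w | (t < X v w)%R]) (g t (X v w - t)%R)%:E)%E.
  rewrite [RHS]integral_mkcond; apply: eq_integral => w _.
  rewrite patchE; case: ifPn; first by rewrite inE /g subrK /ft /= => ->.
  rewrite notin_setE /ft /= => /negP/negbTE ->; congr EFin.
  (* Off the exceedance the integrand is the zero function, and [kiter_bounds] with bound 0 squeezes
     its iterate to 0. *)
  have c0 : measurable_fun setT (fun _ : full => 0 : R) by exact: measurable_cst.
  have c00 (z : full) : 0 <= (fun _ : full => 0 : R) z <= 0 by rewrite lexx.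
  by have := kiter_bounds N.+1 (X v w) c0 c00; rewrite andbC -eq_le => /eqP.
rewrite (memoryless expX (g := fun y => (g t y)%:E))//; last 2 first.
- by apply/measurable_EFinP; exact: measurable_g.
- by move=> y; rewrite lee_fin; have /andP[] := g_bounds t y.
by rewrite PD muleA -EFinM mulVf ?mul1e// gt_eqF// expR_gt0.
Qed.

Let liter_w w := liter N.+1 (fun z => f (X v w, z)).

Let liter_wE w : liter_w w = \int[noise N.+1]_xi f (X v w, zrec N.+1 xi).
Proof. by rewrite (@integral_zrec N.+1 (fun z => f (X v w, z)) B). Qed.

Let cvg_g w (s : R^nat) : s n @[n --> \oo] --> +oo ->
  g (s n) (X v w) @[n --> \oo] --> liter_w w.
Proof.
move=> soo; have shift : X v w + s n @[n --> \oo] --> +oo.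
  apply/cvgryPge => A; near=> n; rewrite -lerBlDl; near: n.
  by move/cvgryPge : soo; apply.
apply: (cvg_comp _ _ shift (kiter_cvg (leqnn N) (h := fun _ z => f (X v w, z))
  (B := B) _ _ _)) => //.
have cfw := cf (y := X v w).
move=> z0.
have snd_cvg : p.2 @[p --> filter_prod (pinfty_nbhs R) (nbhs z0)] --> z0.
  exact: cvg_snd.
exact: (cvg_comp _ _ snd_cvg (cfw z0)).
Unshelve. all: by end_near. Qed.

Let measurable_g_X t : measurable_fun setT (fun w => g t (X v w)).
Proof.
by apply: (measurableT_comp (measurable_g t)); exact: measurable_funP.
Qed.

Let measurable_liter_w : measurable_fun setT liter_w.
Proof.
apply: (@measurable_fun_cvg _ _ _ _ (fun n w => g n%:R (X v w))) => //.
by move=> w _; apply: cvg_g; exact: cvgr_idn.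
Qed.

Let liter_w_bounds w : 0 <= liter_w w <= B.
Proof.
rewrite liter_wE; apply: Rintegral_bounds => //; first exact: probability_setT.
by apply: (measurableT_comp (mfy _)); exact: measurable_zrec.
Qed.

(** For fixed w the overshoot stays constant while the level tends to infinity, so continuity of [f]
    in the state is enough for the pointwise limit. *)
Lemma cvg_law_given :
  fine (\int[law_given P [set w | (t < X v w)%R] (Yt t)]_p (f p)%:E)%E
    @[t --> +oo] -->
  \int[P]_w \int[noise N.+1]_xi f (X v w, zrec N.+1 xi).
Proof.
have -> : \int[P]_w \int[noise N.+1]_xi f (X v w, zrec N.+1 xi)
    = \int[P]_w liter_w w.
  by apply: eq_Rintegral => w _; rewrite liter_wE.
have : \int[P]_w g t (X v w) @[t --> +oo] --> \int[P]_w liter_w w.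
  (* Dominated convergence is sequential, hence the reduction to sequences tending to infinity. *)
  apply/cvg_pinftyP => s soo; apply: fine_cvg.
  rewrite (EFin_Rintegral (probability_setT P) measurable_liter_w liter_w_bounds).
  apply: (@dominated_cvg _ _ _ _ _ measurableT _ _ (cst B%:E)) => //.
  - by move=> n; apply/measurable_EFinP.
  - by move=> w _; apply: cvg_EFin; [exact: nearW|exact: cvg_g].
  - exact: (@finite_measure_integrable_cst _ _ _ _ _ B).
  - move=> n w _; have /andP[h1 h2] := g_bounds (s n) (X v w).
    by rewrite gee0_abs lee_fin.
apply: cvg_trans; apply: near_eq_cvg; near=> t.
rewrite Rintegral_law_given//; near: t; exact: nbhs_pinfty_ge.
Unshelve. all: by end_near. Qed.

End limit.

End clique_step.

(** * Assembly on the product space *)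

Theorem theorem1 (R : realType) (dO : measure_display)
    (Omega : measurableType dO) (P : probability Omega R)
    (d : nat) (e : rel 'I_d) (v : 'I_d)
    (N : nat) (C : 'I_N.+1 -> {set 'I_d})
    (X : 'I_d -> {RV P >-> R})
    (K : forall i, R.-pker (vec R (sep v C i)) ~> (vec R (res v C i)))
    (G : forall i, probability (vec R (res v C i)) R)
    (a1 b1 : R -> vec R (res v C ord0))
    (a b : R -> 'I_d -> R)
    (aS bS psi phi : forall i, vec R (sep v C i) -> vec R (res v C i)) :
  symmetric e -> irreflexive e ->
  graph_connected e -> chordal e -> clique_ordering e v C ->
  graphical_model e X K ->
  assumption_A0 X ->
  assumption_A1 K G a1 b1 ->
  assumption_A2 K G a1 b1 a b aS bS psi phi ->
  (forall z u, psi ord0 z u = 0) -> (forall z u, phi ord0 z u = 1) ->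
  exists (dQ : measure_display) (Omega' : measurableType dQ)
    (Q : probability Omega' R) (E : {RV Q >-> R}) (Z : 'I_d -> {RV Q >-> R})
    (eps : forall i, {RV Q >-> vec R (res v C i)}),
    weakly_cvg
      (fun t => law_given P [set w | t < X v w]
         (fun w => (X v w - t,
            standardize (subvec [set~ v]%SET (a (X v w)))
                        (subvec [set~ v]%SET (b (X v w)))
                        (subrv [set~ v]%SET X w))))
      (pushforward Q (fun w => (E w, subrv [set~ v]%SET Z w))) /\
    [/\ unit_exponential E,
        independent Q E (subrv [set~ v]%SET Z) &
        {ae Q, forall w, Z v w = 0}] /\
    [/\ forall i, {ae Q, forall w, forall u,
          subrv (res v C i) Z w u =
            psi i (subrv (sep v C i) Z w) u
              + phi i (subrv (sep v C i) Z w) u * eps i w u},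
        forall i (B : set (vec R (res v C i))), measurable B ->
          distribution Q (eps i) B = G i B &
        mutually_independent Q (fun i => eps i : Omega' -> vec R (res v C i))].
Proof.
move=> _ _ _ _ Cord GM A0 A1 A2 psi0 phi0.
have vC := clique_root Cord.
pose nu := noise G N.+1.
pose zlim := zrec psi phi N.+1.
have mzlim : measurable_fun setT zlim by exact: (measurable_zrec A2 psi0 phi0).
pose Q : probability (Omega * vec R [set: 'I_d]%SET)%type R := (P \x nu)%E.
have mE : measurable_fun setT (X v \o fst : Omega * vec R [set: 'I_d]%SET -> R).
  by apply: measurableT_comp.
have mZ u : measurable_fun setT
    (fun p : Omega * vec R [set: 'I_d]%SET => entry (zlim p.2) u).
  apply: (measurableT_comp (measurable_entry u)).
  exact: (measurableT_comp mzlim).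
have meps i : measurable_fun setT
    (fun p : Omega * vec R [set: 'I_d]%SET => slice (res v C i) p.2).
  exact: (measurableT_comp (@measurable_slice _ _ _)).
pose E : {RV Q >-> R} := mfun_Sub (mem_set mE).
pose Z u : {RV Q >-> R} := mfun_Sub (mem_set (mZ u)).
pose eps i : {RV Q >-> vec R (res v C i)} := mfun_Sub (mem_set (meps i)).
exists _, _, Q, E, Z, eps.
have QX A B : measurable A -> measurable B -> Q (A `*` B) = (P A * nu B)%E.
  by move=> mA mB; exact: product_measure1E.
have Qfst A : measurable A -> Q (fst @^-1` A) = P A.
  move=> mA; rewrite (_ : fst @^-1` A = A `*` setT); last first.
    by apply/seteqP; split=> -[w z] //= [].
  by rewrite QX// probability_setT mule1.
have Qsnd A : measurable A -> Q (snd @^-1` A) = nu A.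
  move=> mA; rewrite (_ : snd @^-1` A = setT `*` A); last first.
    by apply/seteqP; split=> -[w z] //= [].
  by rewrite QX// probability_setT mul1e.
have mX u B : measurable B -> measurable (X u @^-1` B).
  by move=> mB; rewrite -[_ @^-1` _]setTI; exact: measurable_funP.
split; [|split; split].
- move=> f f_bc; have [cf [M fM]] := f_bc.
  have mf : measurable_fun setT f.
    by apply: discretizable_continuous_measurable => //; exact: discretizable_prod.
  (* The test function is made nonnegative and read on full states, forgetting the [v]-entry. *)
  pose F (p : R * vec R [set: 'I_d]%SET) : R :=
    f (p.1, slice [set~ v]%SET p.2) + M.
  have mF : measurable_fun setT F.
    apply: measurable_funD => //; apply: (measurableT_comp mf).
    apply: measurable_fun_pair => //; apply: measurableT_comp => //.
    exact: measurable_slice.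
  have FB p : 0 <= F p <= M + M.
    have := fM (p.1, slice [set~ v]%SET p.2); rewrite ler_norml /F.
    by move=> /andP[h1 h2]; apply/andP; split; lra.
  have cF y : continuous (fun z => F (y, z)).
    move=> z.
    have yz : (y, slice [set~ v]%SET z') @[z' --> z] --> (y, slice [set~ v]%SET z).
      apply: (@cvg_pair _ _ _ (nbhs z) (nbhs y) (nbhs (slice [set~ v]%SET z))).
        exact: cvg_cst.
      by apply: cvg_slice; exact: cvg_id.
    apply: (@cvgD _ _ _ (nbhs z) _ (fun z' => f (y, slice [set~ v]%SET z'))
      (fun=> M)); first exact: (cvg_comp _ _ yz (cf _)).
    exact: cvg_cst.
  have := @cvg_law_given _ _ _ _ _ K G a1 b1 a b aS bS psi phi A1 A2 vC psi0 phi0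
    _ _ _ X e GM (A0 v) F (M + M) mF FB cF.
  have mEZ : measurable_fun setT (fun w => (E w, subrv [set~ v]%SET Z w)).
    apply: measurable_fun_pair; first exact: mE.
    by apply: measurable_subvec => u _; exact: mZ.
  have -> : fine (\int[pushforward Q (fun w => (E w, subrv [set~ v]%SET Z w))]_x
      (f x)%:E)%E = \int[P]_w \int[nu]_xi F (X v w, zlim xi) - M.
    pose m := pushforward_measure
      Q mEZ.
    have m1 : m setT = 1%E by exact: (probability_setT Q).
    rewrite [LHS](Rintegral_shift m1 mf fM); congr (_ - M).
    rewrite /Rintegral ge0_integral_pushforward//; last 2 first.
    - by apply/measurable_EFinP; exact: measurable_funD.
    - by move=> y _; rewrite lee_fin; have := fM y; rewrite ler_norml => /andP[]; lra.
    rewrite preimage_setT.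
    have mFX : measurable_fun setT
        (fun p : Omega * vec R [set: 'I_d]%SET => (F (X v p.1, zlim p.2))%:E).
      apply/measurable_EFinP; apply: (measurableT_comp mF).
      by apply: measurable_fun_pair => //; exact: (measurableT_comp mzlim).
    rewrite [X in fine X](_ : _ = \int[P]_w \int[nu]_xi (F (X v w, zlim xi))%:E)%E.
      congr fine; apply: eq_integral => w _.
      rewrite (EFin_Rintegral (probability_setT nu) _ (fun xi => FB (X v w, zlim xi)))//.
      apply: (measurableT_comp mF); apply: measurable_fun_pair => //.
    rewrite -(fubini_tonelli1 (fun p => (F (X v p.1, zlim p.2))%:E))//.
    by move=> p; rewrite lee_fin; have /andP[] := FB (X v p.1, zlim p.2).
  move=> H; apply: (cvg_trans _ (cvgB H (cvg_cst M))).
  apply: near_eq_cvg; near=> t.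
  have t0 : 0 <= t by near: t; exact: nbhs_pinfty_ge.
  pose D := [set w | t < X v w].
  have mD : measurable D by exact: measurable_gt.
  pose Yt w : R * vec R [set: 'I_d]%SET :=
    (X v w - t, std_state v a b (seen v C N.+1) (X ^~ w)).
  pose Y w := ((Yt w).1, slice [set~ v]%SET (Yt w).2).
  have mYt : measurable_fun setT Yt.
    apply: measurable_fun_pair; first exact: measurable_funB.
    by apply: (measurable_std_state A2) => u; exact: measurable_funP.
  have mY : measurable_fun setT Y.
    apply: measurable_fun_pair; first exact: (measurableT_comp _ mYt).
    apply: (measurableT_comp (@measurable_slice _ _ _)).
    exact: (measurableT_comp _ mYt).
  have PD0 : P D != 0%E.
    rewrite (exponential_tail (A0 v)) eqe gt_eqF// lt_min expR_gt0 ltr01//.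
  (* On the exceedance of [t >= 0] the value X_v is nonnegative, so the total normings are [a] and
     [b] away from [v]. *)
  have -> : law_given P D (fun w => (X v w - t,
      standardize (subvec [set~ v]%SET (a (X v w)))
        (subvec [set~ v]%SET (b (X v w))) (subrv [set~ v]%SET X w)))
      = law_given P D Y.
    apply: eq_law_given => w tX; congr (_, _); apply/funext => -[u uV].
    have uv : u != v by move: uV; rewrite !inE.
    have Xv0 : 0 <= X v w by rewrite (le_trans t0)// ltW.
    rewrite /standardize /slice /subrv /subvec /= /std_state entry_subvec.
    by rewrite (seen_full Cord) inE /anorm /bnorm (negbTE uv) Xv0.
  rewrite (Rintegral_law_given_shift mD mY PD0 mf fM); congr (fine _ - M).
  rewrite (ge0_integral_law_given P mD mY); last 2 first.
  - by apply/measurable_EFinP; exact: measurable_funD.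
  - by move=> y; rewrite lee_fin; have := fM y; rewrite ler_norml => /andP[]; lra.
  rewrite (ge0_integral_law_given P mD mYt)//; first exact/measurable_EFinP.
  by move=> p; rewrite lee_fin; have /andP[] := FB p.
- move=> x; rewrite -(A0 v x) /cdf /distribution /pushforward.
  by rewrite -[RHS]Qfst//; exact: mX.
- move=> B1 B2 mB1 mB2.
  have mZ2 : measurable [set z | B2 (slice [set~ v]%SET (zlim z))].
    rewrite -[X in measurable X]setTI.
    exact: (measurableT_comp (@measurable_slice _ _ _) mzlim).
  (* [E] reads the first factor and [Z] the second, so the joint event is a rectangle. *)
  rewrite [LHS](_ : _ = Q ((X v @^-1` B1) `*`
    [set z | B2 (slice [set~ v]%SET (zlim z))])); last first.
    by congr (Q _); apply/seteqP; split=> -[w z].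
  rewrite QX//; last exact: mX.
  by congr (_ * _)%E; rewrite -?Qfst -?Qsnd//; exact: mX.
- by apply: aeW => -[w z]; exact: zrec_root.
- by move=> i; apply: aeW => -[w z] u; exact: zrec_eq.
- move=> i B mB; rewrite -(noise_marginal G vC mB) /distribution /pushforward.
  rewrite -Qsnd// -[_ @^-1` _]setTI; exact: measurable_slice.
- move=> J B mB.
  have mS i : measurable (slice (res v C i) @^-1` B i).
    rewrite -[_ @^-1` _]setTI.
    exact: (@measurable_slice R 'I_d (res v C i) measurableT (B i) (mB i)).
  transitivity (Q (snd @^-1` \bigcap_(i in [set` J]) (slice (res v C i) @^-1` B i))).
    by congr (Q _); apply/seteqP; split=> -[w xi].
  rewrite Qsnd; last exact: fin_bigcap_measurable.
  rewrite (noise_mutually_independent G vC)//; apply: eq_bigr => i _.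
  by rewrite -Qsnd.
Unshelve. all: by end_near. Qed.
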